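(* Consider a nearest-neighbor mixture process (NNMP) $\{Z(\boldsymbol v):\boldsymbol v\in\mathcal D\}$ for which the component density $f_{\boldsymbol v,l}$ is specified by the conditional density of $U_{\boldsymbol v,l}$ given $V_{\boldsymbol v,l}$, where the random vector $(U_{\boldsymbol v,l},V_{\boldsymbol v,l})$ follows a bivariate distribution with marginal distribution functions $F_{U_{\boldsymbol v,l}}$ and $F_{V_{\boldsymbol v,l}}$, for $l=1,\dots,L$. Suppose that the spatial dependence of the random vector $(U_{\boldsymbol v,l},V_{\boldsymbol v,l})$ is built from the base vector $(U_l,V_l)$, which has a bivariate distribution such that $U_l$ is stochastically increasing in $V_l$, for $l=1,\dots,L$. Suppose further that, for all $l$, the base random vector $(U_l,V_l)$ is exchangeable (i.e. $(U_l,V_l)$ and $(V_l,U_l)$ have the same joint distribution), and its bivariate distribution, with marginals $F_{U_l}=F_{V_l}$, has first order partial derivatives. Then the upper and lower tail dependence coefficients $\lambda_{\mathcal H}(\boldsymbol v)$ and $\lambda_{\mathcal L}(\boldsymbol v)$ of $Z(\boldsymbol v)$ given its nearest neighbors satisfy $$\lambda_{\mathcal H}(\boldsymbol v)\ \ge\ \sum_{l=1}^L w_l(\boldsymbol v)\,\lambda_{\mathcal H,l}(\boldsymbol v)/2,\qquad \lambda_{\mathcal L}(\boldsymbol v)\ \ge\ \sum_{l=1}^L w_l(\boldsymbol v)\,\lambda_{\mathcal L,l}(\boldsymbol v)/2,$$ where $\lambda_{\mathcal H,l}(\boldsymbol v)$ and $\lambda_{\mathcal L,l}(\boldsymbol v)$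 are the upper and lower tail dependence coefficients with respect to $(U_{\boldsymbol v,l},V_{\boldsymbol v,l})$.
   Context: Nearest-neighbor mixture process (NNMP). Let $\mathcal D\subset\mathbb R^p$, $p\ge 1$, and let $\mathcal S=\{\boldsymbol s_1,\dots,\boldsymbol s_n\}\subset\mathcal D$ be a finite ordered collection of locations (the reference set); $L$ is a positive integer, much smaller than $n$. For $\boldsymbol v=\boldsymbol s_i\in\mathcal S$, $i\ge2$, the neighbor set $\mathrm{Ne}(\boldsymbol s_i)\subset\{\boldsymbol s_1,\dots,\boldsymbol s_{i-1}\}$ consists of the $i_L:=\min(i-1,L)$ locations closest to $\boldsymbol s_i$; for $\boldsymbol v\in\mathcal D\setminus\mathcal S$, $\mathrm{Ne}(\boldsymbol v)\subset\mathcal S$ consists of the $L$ locations of $\mathcal S$ closest to $\boldsymbol v$. The elements of $\mathrm{Ne}(\boldsymbol v)$ in ascending order of distance to $\boldsymbol v$ are $\boldsymbol v_{(1)},\dots,\boldsymbol v_{(L)}$. The process is characterized by the conditional density of $Z(\boldsymbol v)$ given $\boldsymbol Z_{\mathrm{Ne}(\boldsymbol v)}=(Z(\boldsymbol v_{(1)}),\dots,Z(\boldsymbol v_{(L)}))$, $$p(z(\boldsymbol v)\mid\boldsymbol z_{\mathrm{Ne}(\boldsymbol v)})=\sum_{l=1}^{L}w_l(\boldsymbol v)\,f_{\boldsymbol v,l}(z(\boldsymbol v)\mid z(\boldsymbol v_{(l)})),\quad w_l(\boldsymbol v)\ge0,\ \sum_{l} w_l(\boldsymbol v)=1$$ (for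 $\boldsymbol v=\boldsymbol s_i$ with $i\le L$ the index $L$ is replaced by $i_L$). The joint density over $\mathcal S$ is $p(z(\boldsymbol s_1))\prod_{i=2}^n p(z(\boldsymbol s_i)\mid\boldsymbol z_{\mathrm{Ne}(\boldsymbol s_i)})$, and, given the values over $\mathcal S$, the values at finitely many non-reference locations $\boldsymbol u_1,\dots,\boldsymbol u_r$ have joint conditional density $\prod_{i=1}^r p(z(\boldsymbol u_i)\mid\boldsymbol z_{\mathrm{Ne}(\boldsymbol u_i)})$. Base random vectors. For each $l$, $(U_l,V_l)$ is a random vector with a bivariate distribution; ''$(U_{\boldsymbol v,l},V_{\boldsymbol v,l})$ is built from $(U_l,V_l)$'' means that its distribution is obtained by extending some of the parameters of the distribution of $(U_l,V_l)$ to be spatially varying, i.e. indexed by $\boldsymbol v$. The properties assumed of the base vector (stochastic increase, exchangeability, equal marginals, first order partial derivatives) are understood to carry over to $(U_{\boldsymbol v,l},V_{\boldsymbol v,l})$ for every $\boldsymbol v$. Stochastically increasing: $U$ is stochastically increasing in $V$ if $P(U>u\mid V=v)$ increases (is nondecreasing) as $v$ increases. Tail dependence coefficients of a bivariate vector $(U,V)$ with marginal distribution functions $F_U,F_V$: upper $\lim_{q\to1^-}P(U>F_U^{-1}(q)\mid V>F_V^{-1}(q))$; lower $\lim_{q\to0^+}P(U\le F_U^{-1}(q)\mid V\le F_V^{-1}(q))$. Applied to $(U_{\boldsymbol v,l},V_{\boldsymbol v,l})$ these give $\lambda_{\mathcal H,l}(\boldsymbol v)$ and $\lambda_{\mathcal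 L,l}(\boldsymbol v)$. Tail dependence coefficients of $Z(\boldsymbol v)$ given its nearest neighbors: with $F_{Z(\boldsymbol v)}$ the marginal distribution function of $Z(\boldsymbol v)$, $$\lambda_{\mathcal H}(\boldsymbol v)=\lim_{q\to1^-}P\big(Z(\boldsymbol v)>F_{Z(\boldsymbol v)}^{-1}(q)\mid Z(\boldsymbol v_{(1)})>F_{Z(\boldsymbol v_{(1)})}^{-1}(q),\dots,Z(\boldsymbol v_{(L)})>F_{Z(\boldsymbol v_{(L)})}^{-1}(q)\big),$$ $$\lambda_{\mathcal L}(\boldsymbol v)=\lim_{q\to0^+}P\big(Z(\boldsymbol v)\le F_{Z(\boldsymbol v)}^{-1}(q)\mid Z(\boldsymbol v_{(1)})\le F_{Z(\boldsymbol v_{(1)})}^{-1}(q),\dots,Z(\boldsymbol v_{(L)})\le F_{Z(\boldsymbol v_{(L)})}^{-1}(q)\big).$$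
   Formalization: The formal theorem additionally assumes that each V_{v,l} has the same marginal distribution as Z(v_(l)), the neighbor value it stands for; without this the inequality can fail, e.g. with L=1, Z(s_1) uniform on (0,1) and a heavy-tailed pair (U,V). *)

(* Defs.v *)
From HB Require Import structures.
From mathcomp Require Import all_boot all_order all_algebra.
From mathcomp Require Import all_classical all_reals all_analysis.

Set Implicit Arguments.
Unset Strict Implicit.
Unset Printing Implicit Defensive.

Import Order.TTheory GRing.Theory Num.Theory.
Import numFieldNormedType.Exports.

Local Open Scope classical_set_scope.
Local Open Scope ring_scope.

(* ---- Random variables: quantiles, tail dependence ---- *)

Section tail_dependence.
Context d (T : measurableType d) (R : realType) (P : probability T R).

(* The generalized inverse F_X^{-1}(q); a genuine infimum for 0 < q < 1. *)
Definition quantile (X : {RV P >-> R}) (q : R) : R :=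
  inf [set x : R | (q%:E <= cdf X x)%E].

Definition cond_prob (A B : set T) : R := fine (P (A `&` B)) / fine (P B).

(* [lam] is the upper (lower) tail dependence coefficient of X given
   Y_1, ..., Y_k: the defining limit exists and is equal to [lam]. *)
Definition upper_tail_dependence (X : {RV P >-> R}) (k : nat)
    (Y : 'I_k -> {RV P >-> R}) (lam : R) : Prop :=
  cond_prob [set t | quantile X q < X t]
            [set t | forall l, quantile (Y l) q < Y l t]
    @[q --> (1 : R)^'-] --> lam.

Definition lower_tail_dependence (X : {RV P >-> R}) (k : nat)
    (Y : 'I_k -> {RV P >-> R}) (lam : R) : Prop :=
  cond_prob [set t | X t <= quantile X q]
            [set t | forall l, Y l t <= quantile (Y l) q]
    @[q --> (0 : R)^'+] --> lam.

End tail_dependence.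

(* ---- Bivariate distributions ---- *)

(* A random vector (U, V) is represented by its law [mu], U and V being the
   coordinate projections on the probability space (R * R, mu). *)

Section bivariate.
Context (R : realType).

Definition proj1 : R * R -> R := fst.
Definition proj2 : R * R -> R := snd.

HB.instance Definition _ :=
  isMeasurableFun.Build _ _ _ _ proj1 (@measurable_fst _ _ R R).
HB.instance Definition _ :=
  isMeasurableFun.Build _ _ _ _ proj2 (@measurable_snd _ _ R R).

Variable mu : probability (R * R)%type R.

Definition Ucoord : {RV mu >-> R} := proj1.
Definition Vcoord : {RV mu >-> R} := proj2.

(* [g] is a version of v |-> P(U \in A | V = v). *)
Definition is_cond_prob_given_V (A : set R) (g : R -> R) : Prop :=
  measurable_fun setT g /\
  forall B : set R, measurable B ->
    mu (A `*` B) = (\int[distribution mu Vcoord]_(v in B) (g v)%:E)%E.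

(* P(U > u | V = v) is only determined up to a null set of values v, whence
   the existential quantification over versions [h u v] of it. *)
Definition stochastically_increasing : Prop :=
  exists h : R -> R -> R, forall u : R,
    is_cond_prob_given_V `]u, +oo[ (h u) /\
    {homo h u : v1 v2 / v1 <= v2}.

Definition exchangeable : Prop :=
  forall A : set (R * R), measurable A ->
    mu [set x | A (x.2, x.1)] = mu A.

Definition equal_marginals : Prop :=
  forall x : R, cdf Ucoord x = cdf Vcoord x.

Definition joint_cdf (u v : R) : R := fine (mu (`]-oo, u] `*` `]-oo, v])).

(* The partial derivatives are required at the points (u, v) interior to the
   range of the marginals, 0 < F_U(u) < 1 and 0 < F_V(v) < 1: at the end
   points of, say, an exponential or a uniform law, the joint distribution
   function is not differentiable as a function on the whole plane. *)
Definition has_partial_derivatives : Prop :=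
  forall u v : R,
    (0 < cdf Ucoord u < 1)%E -> (0 < cdf Vcoord v < 1)%E ->
    derivable (fun x => joint_cdf x v) u 1 /\
    derivable (fun y => joint_cdf u y) v 1.

Record base_vector_properties : Prop := BaseVectorProperties {
  base_increasing : stochastically_increasing ;
  base_exchangeable : exchangeable ;
  base_marginals : equal_marginals ;
  base_partials : has_partial_derivatives }.

(* [f u v] is a conditional density f(u | v) of U given V = v. *)
Record is_cond_density (f : R -> R -> R) : Prop := IsCondDensity {
  cond_density_measurable : measurable_fun setT (fun x : R * R => f x.1 x.2) ;
  cond_density_ge0 : forall u v, 0 <= f u v ;
  cond_density_int1 : forall v, (\int[lebesgue_measure]_u (f u v)%:E = 1)%E ;
  cond_density_law : forall A B : set R, measurable A -> measurable B ->
    (mu (A `*` B) =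
     \int[distribution mu Vcoord]_(v in B)
        \int[lebesgue_measure]_(u in A) (f u v)%:E)%E }.

End bivariate.

(* ---- Locations and neighbor sets ---- *)

Section neighbors.
Context (R : realType) (p n : nat).
Implicit Types (s : n.-tuple 'rV[R]_p) (v : 'rV[R]_p).

(* The library norm on 'rV[R]_p is the sup norm, hence this definition. *)
Definition euclidean_dist v1 v2 : R :=
  Num.sqrt (\sum_(j < p) (v1 0 j - v2 0 j) ^+ 2).

(* Reference locations are numbered from 0, and [index v s] is n when v is not
   in s. So the locations that may be neighbors of v are the s_j with
   j < index v s (those preceding v if v is in s, all of s otherwise); the
   number of neighbors is min(i - 1, L) at the i-th location of s, and
   min(n, L) outside of s. *)
Definition nb_size s (L : nat) v : nat := minn (index v s) L.

(* [nb] lists the (indices of the) neighbors of v in ascending order of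
   distance; ties between distances may be broken in any way. *)
Record is_neighbor_list s v k (nb : 'I_k -> 'I_n) : Prop := IsNeighborList {
  nb_inj : injective nb ;
  nb_before : forall l, (nb l < index v s)%N ;
  nb_sorted : forall l l' : 'I_k, (l <= l')%N ->
    euclidean_dist v (tnth s (nb l)) <= euclidean_dist v (tnth s (nb l')) ;
  nb_closest : forall (l : 'I_k) (j : 'I_n),
    (j < index v s)%N -> (forall l', nb l' != j) ->
    euclidean_dist v (tnth s (nb l)) <= euclidean_dist v (tnth s j) }.

End neighbors.

(* [G l] is the parametric family containing the law of the base vector
   (U_l, V_l). The law of (U_{v,l}, V_{v,l}) is the member of that family whose
   parameter is the spatially varying [theta v l]; parameters that are not
   extended to be spatially varying are constant in v. When v has fewer than L
   neighbors, only its first [nb_size s L v] components are used. *)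
Definition spatial_law (R : realType) (p n L : nat) (s : n.-tuple 'rV[R]_p)
    (Theta : 'I_L -> Type)
    (G : forall l : 'I_L, Theta l -> probability (R * R)%type R)
    (theta : 'rV[R]_p -> forall l : 'I_L, Theta l)
    (v : 'rV[R]_p) (l : 'I_(nb_size s L v)) : probability (R * R)%type R :=
  let l' := widen_ord (geq_minr (index v s) L) l in G l' (theta v l').

(* ---- Nearest-neighbor mixture processes ---- *)

(* Integral over R^m with respect to Lebesgue measure, as an iterated
   integral. *)
Fixpoint iterated_integral (R : realType) (m : nat)
    (F : seq R -> \bar R) : \bar R :=
  if m is m'.+1 then
    (\int[lebesgue_measure]_x iterated_integral m' (fun z => F (x :: z)))%E
  else F [::].

Section nnmp.
Context (R : realType) (p n L : nat).
Variables (D : set 'rV[R]_p) (s : n.-tuple 'rV[R]_p).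
Variable nb : forall v : 'rV[R]_p, 'I_(nb_size s L v) -> 'I_n.
Variable w : forall v : 'rV[R]_p, 'I_(nb_size s L v) -> R.
Variable f : forall v : 'rV[R]_p, 'I_(nb_size s L v) -> R -> R -> R.
Variable p1 : R -> R.

(* p(z(v) | z_Ne(v)), where y l is the value at the l-th neighbor of v. *)
Definition nnmp_cond_density (v : 'rV[R]_p) (z : R)
    (y : 'I_(nb_size s L v) -> R) : R :=
  \sum_(l < nb_size s L v) w l * f l z (y l).

(* Joint density over S and the non-reference locations u, at the values z
   (first those over S, then those over u): p(z(s_1)) times the product of the
   conditional densities over the other locations of S and over u. *)
Definition nnmp_joint_density (u : seq 'rV[R]_p) (z : seq R) : R :=
  \prod_(i < n + size u)
    (if i == 0%N :> nat then p1 z`_i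
     else nnmp_cond_density (v := (s ++ u)`_i) z`_i (fun l => z`_(nb l))).

Context d (Omega : measurableType d) (P : probability Omega R).

(* [p1] is the density of Z(s_1); the joint law over S and u is determined by
   its values on measurable rectangles. *)
Record is_nnmp (Z : 'rV[R]_p -> {RV P >-> R}) : Prop := IsNNMP {
  nnmp_p1_measurable : measurable_fun setT p1 ;
  nnmp_p1_ge0 : forall x, 0 <= p1 x ;
  nnmp_weights : forall v, D v -> (0 < index v s)%N ->
    (forall l : 'I_(nb_size s L v), 0 <= w l) /\
    \sum_(l < nb_size s L v) w l = 1 ;
  nnmp_joint_law : forall u : seq 'rV[R]_p,
    uniq u -> (forall x, x \in u -> D x /\ x \notin s) ->
    forall B : nat -> set R, (forall i, measurable (B i)) ->
    P [set t | forall i : 'I_(n + size u), B i (Z (s ++ u)`_i t)] =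
    iterated_integral (n + size u) (fun z =>
      ((\prod_(i < n + size u) \1_(B i) z`_i) * nnmp_joint_density u z)%:E) }.

End nnmp.

(* Main.v *)
(* All Z(v), U_{v,l}, V_{v,l} have the same atomless law nu: by induction on the
   location, the law of Z(v) is a w-mixture of laws of U_{v,l}, and these are the
   laws of the neighbors. For a tail set S (an upper or a lower half-line) the
   kernel y |-> P(U_l in S | V_l = y) is, up to null sets, at least its value at
   the boundary when y is inside S and at most that value outside, by stochastic
   increase. Hence, for a.e. y outside S_x,
     P(Z(v) in S_x | all neighbors in S_x) >= sum_l w_l P(U_l in S_x | V_l = y);
   the conditioning event has positive probability, by the same inequality and
   induction. If the left-hand side is at most c far in the tail, then letting
   S_x increase to S_y gives sum_l w_l P(U_l in S_y | V_l = y) <= c for a.e. y far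
   in the tail. By exchangeability, and since the diagonal is null,
     P(U_l in S_x, V_l in S_x) = 2 P(V_l in S_x, U_l in S_{V_l}),
   so integrating the last bound over y in S_x gives
     sum_l w_l P(U_l in S_x | V_l in S_x) <= 2 c.
   This replaces differentiation of the diagonal section of the copula, and with
   it the existence of a limit of P(U_l in S_x | V_l = x). *)

Require Import Defs.
From HB Require Import structures.
From mathcomp Require Import all_boot all_order all_algebra.
From mathcomp Require Import all_classical all_reals all_analysis.
From mathcomp Require Import ring lra finmap measurable_realfun.

Set Implicit Arguments.
Unset Strict Implicit.
Unset Printing Implicit Defensive.

Import Order.TTheory GRing.Theory Num.Theory.
Import numFieldNormedType.Exports.

Local Open Scope classical_set_scope.
Local Open Scope ring_scope.

(** * Lower integrals, iterated integrals, and measures with a density *)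

(* The integral of a nonnegative function is a supremum over simple functions,
   hence monotone and superadditive even if the function is not measurable. This
   spares the measurability of the integrands of [iterated_integral]. *)
Section lower_integral.
Local Open Scope ereal_scope.
Context d (T : measurableType d) (R : realType).
Variable mu : {measure set T -> \bar R}.
Implicit Types f g : T -> \bar R.
Import HBNNSimple.

Lemma le_integralT f g : (forall x, 0 <= f x) -> (forall x, f x <= g x) ->
  \int[mu]_x f x <= \int[mu]_x g x.
Proof.
move=> f0 fg; have g0 x : 0 <= g x := le_trans (f0 x) (fg x).
rewrite !ge0_integralTE//; apply: le_ereal_sup => _ [h /= hf <-].
by exists h => // x; exact: le_trans (fg x).
Qed.

Lemma integralT_leP f (M : \bar R) : (forall x, 0 <= f x) ->
  (forall h : {nnsfun T >-> R}, (forall x, (h x)%:E <= f x) ->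
     \int[mu]_x (h x)%:E <= M) ->
  \int[mu]_x f x <= M.
Proof.
move=> f0 hM; rewrite ge0_integralTE//; apply: ge_ereal_sup => _ [h hf <-].
have := hM h hf; rewrite integral_nnsfun//.
by congr (_ <= _); congr sintegral; apply/funext => x; rewrite patch_setT.
Qed.

Lemma integralT_scale_ge f (k : R) : (0 <= k)%R -> (forall x, 0 <= f x) ->
  k%:E * \int[mu]_x f x <= \int[mu]_x (k%:E * f x).
Proof.
move=> k0 f0; move: k0; rewrite le_eqVlt => /predU1P[<-|k0].
  by rewrite mul0e; apply: integral_ge0 => x _; rewrite mul0e.
have kf0 x : 0 <= k%:E * f x by rewrite mule_ge0// lee_fin ltW.
rewrite -lee_pdivlMl//; apply: integralT_leP => // h hf.
rewrite lee_pdivlMl// -ge0_integralZl_EFin ?(ltW k0)//; last 2 first.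
- by move=> x _; rewrite lee_fin.
- exact/measurable_EFinP.
apply: le_integralT => x; first by rewrite mule_ge0// lee_fin// ltW.
by rewrite lee_pmul2l.
Qed.

(** Simple minorants of [f] and [g] add up to a minorant of [f + g]. Once the right-hand side [X] is
    known to be finite, the two suprema are taken one after the other, each time with the other
    summand, finite as well, subtracted. *)
Lemma integralT_add_ge f g : (forall x, 0 <= f x) -> (forall x, 0 <= g x) ->
  \int[mu]_x f x + \int[mu]_x g x <= \int[mu]_x (f x + g x).
Proof.
move=> f0 g0; have fg0 x : 0 <= f x + g x by exact: adde_ge0.
set X := \int[mu]_x (f x + g x).
have X0 : 0 <= X by exact: integral_ge0.
have [->|Xy] := eqVneq X +oo; first by rewrite leey.
have Xfin : X \is a fin_num by rewrite ge0_fin_numE// ltey.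
have le_fin (Y : \bar R) : 0 <= Y -> Y <= X -> Y \is a fin_num.
  by move=> Y0 YX; rewrite ge0_fin_numE// (le_lt_trans YX)// ltey.
have gX : \int[mu]_x g x <= X by apply: le_integralT => // x; rewrite leeDr.
have gfin : \int[mu]_x g x \is a fin_num by rewrite le_fin// integral_ge0.
rewrite -leeBrDr//; apply: integralT_leP => // h hf.
have h0 x : 0 <= (h x)%:E by rewrite lee_fin.
have hX : \int[mu]_x (h x)%:E <= X.
  by apply: le_integralT => // x; rewrite (le_trans (hf x))// leeDl.
have hfin : \int[mu]_x (h x)%:E \is a fin_num by rewrite le_fin// integral_ge0.
rewrite leeBrDr// addeC -leeBrDr//; apply: integralT_leP => // k kg.
rewrite leeBrDr//.
have mnn (i : {nnsfun T >-> R}) : measurable_fun setT (EFin \o i).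
  exact/measurable_EFinP.
have nn0 (i : {nnsfun T >-> R}) x : [set: T] x -> 0 <= (EFin \o i) x.
  by rewrite lee_fin.
rewrite -(ge0_integralD mu measurableT (nn0 k) (mnn k) (nn0 h) (mnn h)).
apply: le_integralT => x /=; first by rewrite adde_ge0// lee_fin.
by rewrite addeC leeD.
Qed.

End lower_integral.

Section iterated_integral.
Local Open Scope ereal_scope.
Context (R : realType).
Implicit Types (F G : seq R -> \bar R) (m : nat).
Import HBNNSimple.

Lemma eq_iterated_integral m F G : (forall z, size z = m -> F z = G z) ->
  iterated_integral m F = iterated_integral m G.
Proof.
elim: m F G => [|m IH] F G FG /=; first exact: FG.
by apply: eq_integral => x _; apply: IH => z zm; apply: FG; rewrite /= zm.
Qed.

Lemma iterated_integral_ge0 m F : (forall z, size z = m -> 0 <= F z) ->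
  0 <= iterated_integral m F.
Proof.
elim: m F => [|m IH] F F0 /=; first exact: F0.
by apply: integral_ge0 => x _; apply: IH => z zm; apply: F0; rewrite /= zm.
Qed.

Lemma le_iterated_integral m F G : (forall z, size z = m -> 0 <= F z) ->
  (forall z, size z = m -> F z <= G z) ->
  iterated_integral m F <= iterated_integral m G.
Proof.
elim: m F G => [|m IH] F G F0 FG /=; first exact: FG.
apply: le_integralT => x.
  by apply: iterated_integral_ge0 => z zm; apply: F0; rewrite /= zm.
by apply: IH => z zm; [apply: F0|apply: FG]; rewrite /= zm.
Qed.

Lemma iterated_integral_scale_ge m F (k : R) : (0 <= k)%R ->
  (forall z, size z = m -> 0 <= F z) ->
  k%:E * iterated_integral m F <= iterated_integral m (fun z => k%:E * F z).
Proof.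
move=> k0; elim: m F => [//|m IH] F F0 /=.
have F0' x z : size z = m -> 0 <= F (x :: z) by move=> zm; rewrite F0//= zm.
have iF0 x : 0 <= iterated_integral m (fun z => F (x :: z)).
  by apply: iterated_integral_ge0; exact: F0'.
apply: le_trans (integralT_scale_ge lebesgue_measure k0 iF0) _.
by apply: le_integralT => x; [rewrite mule_ge0|exact/IH/F0'].
Qed.

Lemma iterated_integral_add_ge m F G :
  (forall z, size z = m -> 0 <= F z) -> (forall z, size z = m -> 0 <= G z) ->
  iterated_integral m F + iterated_integral m G <=
  iterated_integral m (fun z => F z + G z).
Proof.
elim: m F G => [//|m IH] F G F0 G0 /=.
have F0' x z : size z = m -> 0 <= F (x :: z) by move=> zm; rewrite F0//= zm.
have G0' x z : size z = m -> 0 <= G (x :: z) by move=> zm; rewrite G0//= zm.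
have iF0 x : 0 <= iterated_integral m (fun z => F (x :: z)).
  by apply: iterated_integral_ge0; exact: F0'.
have iG0 x : 0 <= iterated_integral m (fun z => G (x :: z)).
  by apply: iterated_integral_ge0; exact: G0'.
apply: le_trans (integralT_add_ge lebesgue_measure iF0 iG0) _.
by apply: le_integralT => x; [rewrite adde_ge0|apply: IH;
  [exact: F0'|exact: G0']].
Qed.

Lemma iterated_integral_sum_ge m (I : Type) (r : seq I)
    (F : I -> seq R -> \bar R) :
  (forall i z, size z = m -> 0 <= F i z) ->
  \sum_(i <- r) iterated_integral m (F i) <=
  iterated_integral m (fun z => \sum_(i <- r) F i z).
Proof.
move=> F0; elim: r => [|i r IH].
  rewrite big_nil; apply: iterated_integral_ge0 => z _.
  by rewrite big_nil.
rewrite big_cons; apply: le_trans (leeD (lexx _) IH) _.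
under [leRHS]eq_iterated_integral do rewrite big_cons.
apply: iterated_integral_add_ge; first exact: F0.
by move=> z zm; apply: sume_ge0 => j _; exact: F0.
Qed.

(** The recursion peels off the first variable. The density of the process has to be integrated from
    the last location backwards, because each location is conditioned on earlier ones. *)
Lemma iterated_integralSr m F : iterated_integral m.+1 F =
  iterated_integral m (fun z => \int[lebesgue_measure]_x F (rcons z x)).
Proof.
elim: m F => [//|m IH] F.
by apply: eq_integral => x _; exact: (IH (fun z => F (x :: z))).
Qed.

(** Here [nu] is the law of coordinate [j] under the density [F]. A simple minorant of [g] is split
    into its level sets, the hypothesis applies to each of them, and superadditivity puts the pieces
    back under one iterated integral. *)
Lemma iterated_integral_marginal_ge m (j : nat) (nu : {measure set R -> \bar R})
    (F : seq R -> R) (g : R -> \bar R) :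
  (forall z, size z = m -> 0 <= F z)%R -> (forall x, 0 <= g x) ->
  (forall B : set R, measurable B ->
    nu B = iterated_integral m (fun z => (\1_B z`_j * F z)%:E)) ->
  \int[nu]_x g x <= iterated_integral m (fun z => (F z)%:E * g z`_j).
Proof.
move=> F0 g0 nuE; apply: integralT_leP => // h hg.
rewrite integral_nnsfun// sintegralE/=.
have hT : h \_ setT = h by apply/funext => x; rewrite patch_setT.
rewrite hT fsbig_finite//=.
under eq_bigr => x _ do rewrite nuE//.
have h0 x : x \in fset_set (range h) -> (0 <= x)%R.
  by rewrite in_fset_set// => /set_mem[y _ <-].
(* The maximum with 0 makes every coefficient nonnegative, as [iterated_integral_sum_ge] requires
   for all indices; on the range of [h] it changes nothing. *)
apply: (@le_trans _ _ (\sum_(x <- fset_set (range h)) iterated_integral m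
   (fun z => (Num.max x 0 * \1_(h @^-1` [set x]) z`_j * F z)%:E))).
  rewrite big_seq [leRHS]big_seq; apply: lee_sum => x /h0 x0.
  rewrite (max_idPl x0); apply: le_trans (iterated_integral_scale_ge _ _) _ =>
    //.
    by move=> z zm; rewrite lee_fin mulr_ge0// F0.
  by apply: le_iterated_integral => z zm; rewrite -?EFinM ?lee_fin ?mulrA//
    !mulr_ge0// F0.
apply: le_trans (iterated_integral_sum_ge _ _) _.
  by move=> x z zm; rewrite lee_fin !mulr_ge0 ?F0// le_max lexx orbT.
apply: le_iterated_integral => z zm.
  by apply: sume_ge0 => x _; rewrite lee_fin !mulr_ge0 ?F0// le_max lexx orbT.
apply: (@le_trans _ _ ((F z)%:E * (h z`_j)%:E));
  last by rewrite lee_wpmul2l// lee_fin F0.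
rewrite sumEFin -EFinM lee_fin -mulr_suml mulrC ler_wpM2l ?F0//.
(* At a fixed [z] only the level set of the value [h z_j] contributes. *)
rewrite (bigD1_seq (h z`_j)) ?fset_uniq//=; last first.
  by rewrite in_fset_set//; apply/mem_set; exists z`_j.
rewrite big1_seq ?addr0.
  by rewrite indicE mem_set// mulr1 (max_idPl _).
move=> x /andP[xh _]; rewrite indicE memNset ?mulr0//= => hx.
by rewrite hx eqxx in xh.
Qed.

End iterated_integral.

Section density_measure.
Local Open Scope ereal_scope.
Context d (T : measurableType d) (R : realType).
Variable mu : {measure set T -> \bar R}.
Variables (g : T -> R) (g0 : forall x, (0 <= g x)%R)
  (mg : measurable_fun setT g).

(* The proofs are arguments so that the measure structure can be inferred. *)
Definition density_measure of (forall x, (0 <= g x)%R) &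
    measurable_fun setT g :=
  fun A : set T => \int[mu]_(x in A) (g x)%:E.

Let nu := density_measure g0 mg.

Let nu0 : nu set0 = 0. Proof. exact: integral_set0. Qed.

Let nu_ge0 A : 0 <= nu A.
Proof. by apply: integral_ge0 => x _; rewrite lee_fin. Qed.

Let nu_sigma_additive : semi_sigma_additive nu.
Proof.
move=> A mA tA mUA; rewrite /nu /density_measure ge0_integral_bigcup//.
- by apply: is_cvg_ereal_nneg_natsum_cond => n _ _; exact: nu_ge0.
- exact/measurable_funTS/measurable_EFinP.
- by move=> x _; rewrite lee_fin.
Qed.

HB.instance Definition _ := isMeasure.Build _ _ _
  (density_measure g0 mg) nu0 nu_ge0 nu_sigma_additive.

End density_measure.

(** * Upper and lower half-lines, treated uniformly *)

(* Strict on both sides, so that [tail b y] is the union of the [tail b x] with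
   x in [tail b y]. *)
Definition tail (R : realType) (b : bool) (x : R) : set R :=
  if b then `]x, +oo[%classic else `]-oo, x[%classic.

Section tail.
Context (R : realType).
Implicit Types (b : bool) (x y : R).

Lemma measurable_tail b x : measurable (tail b x).
Proof. by case: b; exact: measurable_itv. Qed.

Lemma tailE b x y : tail b x y = (if b then x < y else y < x).
Proof. by case: b; rewrite /tail /= in_itv /= ?andbT. Qed.

Lemma tail_negb b x y : tail (~~ b) x y = tail b y x.
Proof. by rewrite !tailE; case: b. Qed.

Lemma tail_irrefl b x : ~ tail b x x.
Proof. by rewrite tailE; case: b; rewrite ltxx. Qed.

Lemma tail_total b x y : [\/ tail b x y, x = y | tail b y x].
Proof.
rewrite !tailE; case: b; case: (ltgtP x y) => h;
  by [constructor 1|constructor 2|constructor 3].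
Qed.

Lemma tail_trans b x y z : tail b x y -> tail b y z -> tail b x z.
Proof.
rewrite !tailE; case: b; first exact: lt_trans.
by move=> yx zy; exact: lt_trans yx.
Qed.

Lemma tail_asym b x y : tail b x y -> ~ tail b y x.
Proof. by move=> xy yx; apply: (@tail_irrefl b x); exact: tail_trans yx. Qed.

Lemma tail_rat b x y : tail b x y ->
  exists q : rat, tail b x (ratr q) /\ tail b (ratr q) y.
Proof.
rewrite tailE; case: b => xy.
  by have [q] := rat_in_itvoo xy; rewrite in_itv => /andP[? ?]; exists q;
    rewrite !tailE.
by have [q] := rat_in_itvoo xy; rewrite in_itv => /andP[? ?]; exists q;
  rewrite !tailE.
Qed.

(** The tail at [y] is the increasing union of the tails at points [a n] that approach [y] from
    inside, so continuity from below applies. The hypothesis is limited to rational thresholds so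
    that it can be drawn from countably many almost sure statements. *)
Lemma tail_continuous d (T : measurableType d) (m : {measure set T -> \bar R})
    (X : T -> R) b y (c : \bar R) : measurable_fun setT X ->
  (forall q : rat, tail b y (ratr q) -> (m (X @^-1` tail b (ratr q)) <= c)%E) ->
  (m (X @^-1` tail b y) <= c)%E.
Proof.
move=> mX mc; pose a n : R := if b then y + n.+1%:R^-1 else y - n.+1%:R^-1.
have tya n : tail b y (a n).
  by rewrite tailE /a; case: b {mc a}; rewrite ?ltrDl ?gtrBl invr_gt0.
have mt x : measurable (X @^-1` tail b x).
  by rewrite -[_ @^-1` _]setTI; apply: mX => //; exact: measurable_tail.
have mta n := mt (a n).
have ta : X @^-1` tail b y = \bigcup_n X @^-1` tail b (a n).
  rewrite -preimage_bigcup; congr (_ @^-1` _).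
  apply/seteqP; split => z; last by move=> [n _]; exact: tail_trans.
  rewrite tailE => yz.
  have [n] : exists n, n.+1%:R^-1 < `|z - y|.
    have zy : 0 < `|z - y|.
      by rewrite normr_gt0 subr_eq0; case: b yz {mc a tya mt mta} => /lt_eqF;
        rewrite 1?eq_sym => ->.
    by have [k _ /(_ k (leqnn k)) h] := near_infty_natSinv_lt (PosNum zy);
      exists k.
  move=> hn; exists n => //; rewrite tailE /a;
    case: b yz {mc a tya mt mta} hn => yz.
    by rewrite gtr0_norm ?subr_gt0// ltrBrDl.
  by rewrite ltr0_norm ?subr_lt0// opprB => h; rewrite ltrBrDr addrC -ltrBrDr.
have nd : nondecreasing_seq (fun n => X @^-1` tail b (a n)).
  move=> n k nk; apply/subsetPset => z; rewrite /preimage /mkset.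
  have nk' : k.+1%:R^-1 <= n.+1%:R^-1 :> R by rewrite lef_pV2 ?posrE// ler_nat
    ltnS.
  rewrite !tailE /a; case: b {mc a tya mt mta ta}.
    by apply: le_lt_trans; rewrite lerD2l.
  by move=> h; apply: lt_le_trans h _; rewrite lerD2l lerN2.
have cv := @nondecreasing_cvg_mu _ _ _ m _ mta (bigcupT_measurable _ mta) nd.
rewrite ta -(cvg_lim _ cv)//; apply: lime_le; first by apply/cvg_ex; eexists;
  exact: cv.
(* The tail at a rational between [y] and [a n] contains the tail at [a n]. *)
apply: nearW => n /=; have [q [yq qa]] := tail_rat (tya n).
apply: le_trans (mc q yq); apply: le_measure;
  [exact/mem_set/mt|exact/mem_set/mt|].
by move=> z; exact: tail_trans.
Qed.

End tail.

(** * Conditional laws given by a conditional density *)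

Section ocitv_display.
Context (R : realType).

(* [R] and [measurableTypeR R], on which [lebesgue_measure] is defined, have the
   same measurable sets but different displays. *)
Definition prod_id : measurableTypeR R * R -> R * R := fun z => z.

Let measurable_prod_id : measurable_fun setT prod_id.
Proof. by move=> _ X mX; rewrite setTI; exact: mX. Qed.

HB.instance Definition _ := isMeasurableFun.Build _ _ _ _ prod_id
  measurable_prod_id.

End ocitv_display.

(** The version of P(U in A | V = y) supplied by a conditional density; for fixed [y] it is a
    measure in [A], unlike an arbitrary version of the conditional probability. *)
Definition cond_law (R : realType) (f : R -> R -> R) (A : set R) (y : R) :
    \bar R :=
  (\int[lebesgue_measure]_(u in A) (f u y)%:E)%E.

Section conditional_law.
Local Open Scope ereal_scope.
Context (R : realType) (mu : probability (R * R)%type R) (f : R -> R -> R).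
Hypothesis fP : is_cond_density mu f.
Local Notation nu := (distribution mu (Vcoord mu)).
Local Notation leb := (@lebesgue_measure R).

Let f0 u v : (0 <= f u v)%R. Proof. exact: cond_density_ge0 fP u v. Qed.

Lemma measurable_cond_density v :
  measurable_fun [set: measurableTypeR R] (f^~ v).
Proof.
exact: (measurableT_comp (cond_density_measurable fP) (pair2_measurable v)).
Qed.

Lemma cond_law_ge0 A y : 0 <= cond_law f A y.
Proof. by apply: integral_ge0 => u _; rewrite lee_fin. Qed.

Lemma cond_lawT y : cond_law f setT y = 1.
Proof. exact: cond_density_int1 fP y. Qed.

Lemma le_cond_law A B y : measurable A -> measurable B -> A `<=` B ->
  cond_law f A y <= cond_law f B y.
Proof.
move=> mA mB AB; apply: ge0_subset_integral => //.
  by apply: measurable_funTS; apply/measurable_EFinP;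
    exact: measurable_cond_density.
by move=> u _; rewrite lee_fin.
Qed.

Lemma cond_law_le1 A y : measurable A -> cond_law f A y <= 1.
Proof. by move=> mA; rewrite -(cond_lawT y); exact: le_cond_law. Qed.

Lemma cond_law_complement A y : measurable A ->
  cond_law f (~` A) y = 1 - cond_law f A y.
Proof.
move=> mA; rewrite -(cond_lawT y) -(setUv A) {2}/cond_law ge0_integral_setU//.
- rewrite -/(cond_law f A y) -/(cond_law f (~` A) y) addeC addeK//.
  by rewrite ge0_fin_numE ?cond_law_ge0// (le_lt_trans (cond_law_le1 _ _))//
    ltry.
- exact: measurableC.
- by apply: measurable_funTS; apply/measurable_EFinP;
  exact: measurable_cond_density.
- by move=> u _; rewrite lee_fin.
- by apply/disj_setPRL.
Qed.

Let mk X : measurable X ->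
  measurable_fun [set: measurableTypeR R * R]
    (fun z : R * R => (\1_X z * f z.1 z.2)%:E).
Proof.
move=> mX; apply/measurable_EFinP/measurable_funM;
  first exact: measurable_indic.
exact: cond_density_measurable fP.
Qed.

Let k0 (X : set (R * R)) z : 0 <= (\1_X z * f z.1 z.2)%:E.
Proof. by rewrite lee_fin mulr_ge0. Qed.

Lemma measurable_cond_density_section (X : set (R * R)) : measurable X ->
  measurable_fun setT (fun v => \int[leb]_u (\1_X (u, v) * f u v)%:E).
Proof.
move=> mX; exact: (@measurable_fun_fubini_tonelli_G _ _ (measurableTypeR R) R R
  leb _ (mk mX) (k0 X)).
Qed.

(** The defining property of a conditional density concerns rectangles. They form a generating
    pi-system, so [mu] equals the measure of density [f] with respect to the product of Lebesgue
    measure and [nu]. This gives access to triangles and to the diagonal. *)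
Lemma cond_density_lawE (X : set (R * R)) : measurable X ->
  mu X = \int[nu]_v \int[leb]_u (\1_X (u, v) * f u v)%:E.
Proof.
move=> mX.
pose m := density_measure (leb \x nu)
  (fun z : measurableTypeR R * R => f0 z.1 z.2) (cond_density_measurable fP).
have mE Y : measurable Y ->
    m Y = \int[nu]_v \int[leb]_u (\1_Y (u, v) * f u v)%:E.
  move=> mY; rewrite /m /density_measure integral_mkcond.
  rewrite -(@fubini_tonelli2 _ _ (measurableTypeR R) R R leb nu _ (mk mY) (k0
    Y)).
  apply: eq_integral => z _; rewrite patchE indicE.
  by case: ifPn; rewrite ?mul1r ?mul0r.
rewrite -mE//.
pose C : set (set (R * R)) :=
  [set Y | exists A, measurable A /\ exists B, measurable B /\ Y = A `*` B].
apply: (measure_unique C (fun=> setT) _ _ _ _ mu (pushforward m (@prod_id R)))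
  => //.
- rewrite measurable_prod_measurableType //; congr (<<s _ >>).
  rewrite predeqE; split => [[A mA [B mB <-]]|[A [mA [B [mB ->]]]]].
    by exists A; split => //; exists B.
  by exists A => //; exists B.
- move=> _ _ [A [mA [B [mB ->]]]] [A' [mA' [B' [mB' ->]]]].
  rewrite -setXI; exists (A `&` A'); split; first exact: measurableI.
  by exists (B `&` B'); split => //; exact: measurableI.
- by move=> _; exists setT; split=> //; exists setT; split=> //; rewrite setXTT.
- by rewrite bigcup_const.
- move=> _ [A [mA [B [mB ->]]]]; transitivity (m (A `*` B)) => //; rewrite mE;
  last exact: measurableX.
  apply: (etrans (cond_density_law fP mA mB)).
  rewrite [LHS]integral_mkcond.
  apply: eq_integral => v _; rewrite patchE; case: ifPn => vB.
    rewrite integral_mkcond; apply: eq_integral => u _;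
      rewrite patchE indicE in_setX vB.
    by rewrite andbT; case: ifPn => //=; rewrite ?mul1r ?mul0r.
  rewrite integral0_eq// => u _; rewrite indicE in_setX (negbTE vB) andbF.
  by rewrite mul0r.
- move=> _; apply: (le_lt_trans (probability_le1 mu measurableT)).
  exact: ltry.
Qed.

Lemma measurable_cond_law A : measurable A ->
  measurable_fun setT (cond_law f A).
Proof.
move=> mA.
have := measurable_cond_density_section (measurableX mA (@measurableT _ R)).
apply: eq_measurable_fun => v _; rewrite /cond_law [RHS]integral_mkcond.
apply: eq_integral => u _; rewrite patchE indicE in_setX in_setT andbT.
by case: ifPn; rewrite ?mul1r ?mul0r.
Qed.

Lemma measurable_tail_graph b : measurable [set z : R * R | tail b z.2 z.1].
Proof.
have m (g h : R * R -> R) : measurable_fun setT g -> measurable_fun setT h ->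
    measurable [set z | (g z < h z)%R].
  move=> mg mh; have := measurable_fun_ltr mg mh.
  by move=> /(_ measurableT [set true] I); rewrite setTI.
have -> : [set z : R * R | tail b z.2 z.1] =
    if b then [set z | (z.2 < z.1)%R] else [set z | (z.1 < z.2)%R].
  by apply/seteqP; split => z /=; rewrite tailE; case: b.
by case: b; apply: m.
Qed.

End conditional_law.

(** * Consequences of exchangeability and stochastic increase for one vector *)

Section base_vector.
Local Open Scope ereal_scope.
Context (R : realType) (mu : probability (R * R)%type R) (f : R -> R -> R).
Hypotheses (fP : is_cond_density mu f) (muP : base_vector_properties mu).
Local Notation nu := (distribution mu (Vcoord mu)).
Local Notation leb := (@lebesgue_measure R).

Let f0 u v : (0 <= f u v)%R. Proof. exact: cond_density_ge0 fP u v. Qed.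

Lemma marginal_VE B : measurable B -> nu B = mu (setT `*` B).
Proof.
by move=> _; congr (mu _); apply/seteqP; split => [z ?|z []].
Qed.

Lemma marginal_UE A : measurable A -> mu (A `*` setT) = nu A.
Proof.
move=> mA; rewrite marginal_VE// -(base_exchangeable muP);
  last exact: measurableX.
by congr (mu _); apply/seteqP; split => z [].
Qed.

(** Given V, the variable U has a Lebesgue density and hence no atoms; exchangeability transfers
    this to V. *)
Lemma marginal_V_atomless x : nu [set x] = 0.
Proof.
rewrite -marginal_UE// (cond_density_law fP)//.
by apply: integral0_eq => v _; rewrite integral_set1.
Qed.

(** The kernel agrees almost everywhere with a version that is monotone in [y], so a single number
    separates its values on the two sides of [c]. *)
Lemma tail_threshold b x c : exists t : R, [/\ (0 <= t)%R,
  {ae nu, forall y, ~ tail b c y -> cond_law f (tail b x) y <= t%:E} &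
  {ae nu, forall y, tail b c y -> t%:E <= cond_law f (tail b x) y}].
Proof.
have [h hP] := base_increasing muP.
have [[mh hE] h_nd] := hP x.
have mx : measurable `]x, +oo[%classic by exact: measurable_itv.
have mcl := measurable_cond_law fP mx.
have ae : ae_eq nu setT (cond_law f `]x, +oo[) (EFin \o h x).
  apply: integral_ae_eq => //.
  - apply/integrableP; split => //.
    rewrite (eq_integral (cond_law f `]x, +oo[)); last first.
      by move=> v _; rewrite gee0_abs// (cond_law_ge0 fP).
    rewrite -(cond_density_law fP)//.
    apply: (le_lt_trans (probability_le1 mu _)); last exact: ltry.
    exact: measurableX.
  - exact/measurable_EFinP.
  - move=> E _ mE; rewrite -hE//; exact/esym/(cond_density_law fP).
(* The value at [c] of the monotone version, or of its complement for a lower tail. The maximum with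
   0 is taken because a version may be negative on a null set. *)
pose t := (Num.max 0 (if b then h x c else 1 - h x c))%R.
have clb y : cond_law f `]x, +oo[ y = (h x y)%:E ->
    cond_law f (tail b x) y = (if b then h x y else 1 - h x y)%R%:E.
  move=> hy; case: b t => _ //.
  (* The lower tail is the complement of a closed half-line, whose end point is negligible for
     Lebesgue measure. *)
  rewrite /tail -setCitvr.
  have mxc : measurable `[x, +oo[%classic by exact: measurable_itv.
  rewrite (cond_law_complement fP)// EFinB -hy; congr (_ - _).
  rewrite /cond_law -(@integral_setD1 _ (fun u => (f u y)%:E) x) ?setDitv1l//.
  by apply: measurable_funTS; apply/measurable_EFinP;
    exact: measurable_cond_density fP y.
exists t; split; first by rewrite le_max lexx.
- apply: filterS ae => y /(_ I)/clb -> /=; rewrite tailE => cy.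
  rewrite lee_fin le_max; apply/orP; right.
  case: b cy {t clb} => /negP; rewrite -leNgt => cy; first exact: h_nd.
  by rewrite lerD2l lerN2; exact: h_nd.
- apply: filterS ae => y /(_ I)/clb cly /= cy.
  have := cond_law_ge0 fP (tail b x) y; move: cly => -> cl0.
  rewrite lee_fin ge_max; apply/andP; split; first by rewrite -lee_fin.
  move: cy; rewrite tailE; case: b cl0 {t clb} => _ /ltW cy; first exact: h_nd.
  by rewrite lerD2l lerN2; exact: h_nd.
Qed.

Lemma measurable_diag_cond_law b :
  measurable_fun setT (fun v => cond_law f (tail b v) v).
Proof.
have := measurable_cond_density_section fP (measurable_tail_graph b).
apply: eq_measurable_fun => v _; rewrite /cond_law [RHS]integral_mkcond.
apply: eq_integral => u _; rewrite patchE indicE.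
rewrite (_ : (u, v) \in _ = (u \in tail b v)); first by case: ifPn;
  rewrite ?mul1r ?mul0r.
by apply/idP/idP => /set_mem; exact: mem_set.
Qed.

(** The square is cut along the diagonal: [L] is the triangle where U lies further out than V, [L']
    its mirror image, of the same mass by exchangeability, and [E] the part of the diagonal band
    that remains. *)
Lemma tail_diagonal b x : mu (tail b x `*` tail b x) =
  2%:E * \int[nu]_(v in tail b x) cond_law f (tail b v) v.
Proof.
pose L := [set z : R * R | tail b x z.2 /\ tail b z.2 z.1].
pose L' := [set z : R * R | L (z.2, z.1)].
pose E := [set z : R * R | z.1 = z.2] `&` (setT `*` tail b x).
have mTt : measurable ([set: R] `*` tail b x).
  by apply: measurableX => //; exact: measurable_tail.
have mtT : measurable (tail b x `*` [set: R]).
  by apply: measurableX => //; exact: measurable_tail.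
have mlt b' : measurable [set z : R * R | tail b' z.2 z.1].
  exact: measurable_tail_graph.
have mE : measurable E.
  apply: measurableI => //.
  have -> : [set z : R * R | z.1 = z.2] =
      ~` ([set z | tail true z.2 z.1] `|` [set z | tail false z.2 z.1]).
    apply/seteqP; split=> [z /= zz [] /=|z zn /=]; first 2 last.
    - case: (tail_total true z.2 z.1) => // h; case: zn; first by left.
      by right; move: h; rewrite /mkset !tailE.
    - by move=> h; apply: (@tail_irrefl _ true z.2);
      rewrite -[X in tail _ _ X]zz.
    - by move=> h; apply: (@tail_irrefl _ false z.2);
      rewrite -[X in tail _ _ X]zz.
  by apply: measurableC; exact: measurableU.
have mL : measurable L.
  have -> : L = (setT `*` tail b x) `&` [set z | tail b z.2 z.1].
    by apply/seteqP; split=> z [] // [].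
  exact: measurableI.
have mL' : measurable L'.
  have -> : L' = (tail b x `*` setT) `&` [set z | tail (~~ b) z.2 z.1].
    apply/seteqP; split=> [z [/= zx zz]|z [[/= zx _]]].
      by split => //; rewrite /mkset tail_negb.
    by rewrite /mkset tail_negb.
  exact: measurableI.
(* Every section of [E] at fixed V has at most one point, which a density does not charge. *)
have muE : mu E = 0.
  rewrite (cond_density_lawE fP mE); apply: integral0_eq => v _.
  transitivity (\int[leb]_(u in [set v]) (\1_E (u, v) * f u v)%:E); last first.
    exact: integral_set1.
  rewrite [RHS]integral_mkcond; apply: eq_integral => u _; rewrite patchE.
  case: ifPn => //; rewrite notin_setE/= => uv.
  by rewrite indicE memNset ?mul0r//= => -[].
have muL : mu L = \int[nu]_(v in tail b x) cond_law f (tail b v) v.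
  rewrite (cond_density_lawE fP mL) [RHS]integral_mkcond;
    apply: eq_integral => v _.
  rewrite patchE; case: ifPn => vx.
    rewrite /cond_law [RHS]integral_mkcond; apply: eq_integral => u _.
    rewrite patchE indicE (_ : (u, v) \in L = (u \in tail b v)).
      by case: ifPn; rewrite ?mul1r ?mul0r.
    apply/idP/idP => /set_mem; first by move=> [_ ?]; exact: mem_set.
    by move=> ?; apply: mem_set; split => //; exact: set_mem.
  apply: integral0_eq => u _; rewrite indicE memNset ?mul0r//= => -[/mem_set].
  by rewrite (negbTE vx).
have -> : tail b x `*` tail b x = (L `|` L') `|` E.
  apply/seteqP; split => [[u v] [/= xu xv]|[u v] [[|]|]] /=.
  - have [uv|uv|uv] := tail_total b u v; [left; right|right|left; left];
    split => //.
  - by move=> [xv vu]; split => //; exact: tail_trans vu.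
  - by move=> [xv vu]; split => //; exact: tail_trans vu.
  - by move=> [/= -> [_ ?]].
have LL' : L `&` L' = set0.
  by apply/seteqP; split => [[u v] [[_ +] [_ +]]|//] /=; exact: tail_asym.
have LE : (L `|` L') `&` E = set0.
  by apply/seteqP; split => [[u v] [[[_ +]|[_ +]] [/= uv _]]|//];
    by rewrite /= uv => /tail_irrefl.
have muU A B : measurable A -> measurable B -> A `&` B = set0 ->
    mu (A `|` B) = mu A + mu B by exact: measureU.
rewrite muU//; last exact: measurableU.
rewrite muU// muE adde0 -muL (base_exchangeable muP mL).
by rewrite (_ : 2%:E = 1 + 1) ?ge0_muleDl ?mul1e// -EFinD.
Qed.

End base_vector.

(** * Finite-dimensional laws of the mixture process *)

Lemma le_measure_ae d (T : measurableType d) (R : realType)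
    (P : probability T R) (A B : set T) : measurable A -> measurable B ->
  {ae P, forall t, A t -> B t} -> (P A <= P B)%E.
Proof.
move=> mA mB AB.
have mAB : measurable (A `\` B) by exact: measurableD.
have nAB : P.-negligible (A `\` B).
  by apply: negligibleS AB => t [At nBt] /(_ At).
rewrite (measureDI P mA mB) (measure_negligible mAB nAB) add0e.
by apply: le_measure; rewrite ?inE//; apply: mem_set => //; exact: measurableI.
Qed.

Section joint_law.
Local Open Scope ereal_scope.
Context (R : realType) (p n L : nat) (D : set 'rV[R]_p) (s : n.-tuple 'rV[R]_p).
Variable nb : forall v : 'rV[R]_p, 'I_(nb_size s L v) -> 'I_n.
Variable w : forall v : 'rV[R]_p, 'I_(nb_size s L v) -> R.
Variable f : forall v : 'rV[R]_p, 'I_(nb_size s L v) -> R -> R -> R.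
Variable mu : forall v : 'rV[R]_p, 'I_(nb_size s L v) ->
  probability (R * R)%type R.
Variable p1 : R -> R.
Context d (Omega : measurableType d) (P : probability Omega R).
Variable Z : 'rV[R]_p -> {RV P >-> R}.
Hypothesis s_uniq : uniq s.
Hypothesis s_D : forall j, D (tnth s j).
Hypothesis nb_neighbors : forall v, D v -> is_neighbor_list s v (@nb v).
Hypothesis f_cond : forall v, D v -> forall l, is_cond_density (mu l) (@f v l).
Hypothesis Z_nnmp : is_nnmp D nb w f p1 Z.
Local Notation leb := (@lebesgue_measure R).
Local Notation cond := (nnmp_cond_density w f).

Section one_location.
Variables (v : 'rV[R]_p) (vD : D v) (v_nb : (0 < index v s)%N).

Lemma nnmp_weight_ge0 l : (0 <= w (v:=v) l)%R.
Proof. by have [] := nnmp_weights Z_nnmp vD v_nb. Qed.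

Lemma nnmp_weight_sum1 : (\sum_l w (v:=v) l = 1)%R.
Proof. by have [] := nnmp_weights Z_nnmp vD v_nb. Qed.

Lemma nnmp_cond_density_ge0 z y : (0 <= cond (v:=v) z y)%R.
Proof.
apply: sumr_ge0 => l _; rewrite mulr_ge0 ?nnmp_weight_ge0//.
exact: cond_density_ge0 (f_cond vD l) _ _.
Qed.

Lemma measurable_nnmp_cond_density y :
  measurable_fun [set: measurableTypeR R] (fun z => cond (v:=v) z y).
Proof.
apply: measurable_sum => l; apply: measurable_funM => //.
exact: measurable_cond_density (f_cond vD l) _.
Qed.

Definition nnmp_cond_law (A : set R) (y : 'I_(nb_size s L v) -> R) : \bar R :=
  \int[leb]_(z in A) (cond z y)%:E.

Lemma nnmp_cond_lawE A y : measurable A ->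
  nnmp_cond_law A y = \sum_l (w (v:=v) l)%:E * cond_law (f (v:=v) l) A (y l).
Proof.
move=> mA; rewrite /nnmp_cond_law.
have fm l := measurable_cond_density (f_cond vD l) (y l).
have fm' l : measurable_fun (A : set (measurableTypeR R))
    (fun z => (f (v:=v) l z (y l))%:E).
  by apply: measurable_funTS; apply/measurable_EFinP; exact: fm.
have f0 l z := cond_density_ge0 (f_cond vD l) z (y l).
under eq_integral do rewrite -sumEFin.
rewrite ge0_integral_sum//.
- apply: eq_bigr => l _; rewrite /cond_law.
  under eq_integral do rewrite EFinM.
  rewrite ge0_integralZl_EFin//; first by move=> z _; rewrite lee_fin f0.
  exact: nnmp_weight_ge0.
- move=> l; apply: measurable_funTS; apply/measurable_EFinP.
  by apply: measurable_funM => //; exact: fm.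
- by move=> l z _; rewrite lee_fin mulr_ge0 ?nnmp_weight_ge0 ?f0.
Qed.

Lemma nnmp_cond_lawT y : nnmp_cond_law setT y = 1.
Proof.
rewrite nnmp_cond_lawE// -(congr1 EFin nnmp_weight_sum1) -sumEFin.
by apply: eq_bigr => l _; rewrite (cond_lawT (f_cond vD l)) mule1.
Qed.

End one_location.

Section prefix.
Variable u : seq 'rV[R]_p.
Hypotheses (u_size : (size u <= 1)%N)
  (u_D : forall x, x \in u -> D x /\ x \notin s).
Local Notation N := (n + size u)%N.
Local Notation loc i := (s ++ u)`_i.

Let loc_D i : (i < N)%N -> D (loc i).
Proof.
move=> iN; rewrite nth_cat size_tuple; case: ltnP => [ni|ni].
  by rewrite -(tnth_nth 0%R s (Ordinal ni)).
by have [] // := @u_D u`_(i - n); rewrite mem_nth// ltn_subLR.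
Qed.

(** Position in [s ++ u] coincides with [index] in [s], also for the outside location, whose index
    is [n]; this is where [u] must have at most one element. Neighbors therefore always stand
    earlier in the list. *)
Let loc_index i : (i < N)%N -> index (loc i) s = i.
Proof.
move=> iN; rewrite nth_cat size_tuple; case: ltnP => [ni|ni].
  by rewrite index_uniq// size_tuple.
have /u_D[_ un] : u`_(i - n) \in u by rewrite mem_nth// ltn_subLR.
rewrite (memNindex un) size_tuple; apply/eqP; rewrite eqn_leq ni -ltnS.
by apply: leq_trans iN _; rewrite -(addn1 n) leq_add2l.
Qed.

Definition prefix_indic (B : nat -> set R) k (z : seq R) : R :=
  (\prod_(i < k) \1_(B i) z`_i)%R.

Definition prefix_density k (z : seq R) : R :=
  (\prod_(i < k) (if i == 0%N :> nat then p1 z`_i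
    else cond (v := loc i) z`_i (fun l => z`_(nb l))))%R.

Lemma prefix_indic_ge0 B k z : (0 <= prefix_indic B k z)%R.
Proof. by apply: prodr_ge0 => i _. Qed.

Lemma prefix_density_ge0 k z : (k <= N)%N -> (0 <= prefix_density k z)%R.
Proof.
move=> kN; apply: prodr_ge0 => i _; case: ifPn => i0;
  first exact: nnmp_p1_ge0 Z_nnmp _.
have iN : (i < N)%N by exact: leq_trans kN.
by apply: nnmp_cond_density_ge0; [exact: loc_D|rewrite loc_index// lt0n].
Qed.

Let nb_lt i (l : 'I_(nb_size s L (loc i))) : (i < N)%N -> (nb l < i)%N.
Proof. by move=> iN; rewrite -[X in (_ < X)%N](loc_index iN);
  exact: nb_before (nb_neighbors (loc_D iN)) l. Qed.

(** The factors before position [k] read only earlier coordinates, so the last variable occurs in a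
    single factor of the density. *)
Lemma prefix_integrate (B : nat -> set R) k z : (0 < k < N)%N -> size z = k ->
  measurable (B k) ->
  \int[leb]_x (prefix_indic B k.+1 (rcons z x) *
      prefix_density k.+1 (rcons z x))%:E =
  (prefix_indic B k z * prefix_density k z)%:E *
    nnmp_cond_law (v := loc k) (B k) (fun l => z`_(nb l)).
Proof.
move=> /andP[k0 kN] zk mB.
have rz j x : (j < k)%N -> (rcons z x)`_j = z`_j.
  by move=> jk; rewrite nth_rcons zk jk.
have rzk x : (rcons z x)`_k = x by rewrite nth_rcons zk ltnn eqxx.
have lD := loc_D kN; have l0 : (0 < index (loc k) s)%N by rewrite loc_index.
have E x : (prefix_indic B k.+1 (rcons z x) * prefix_density k.+1 (rcons z
  x))%:E =
    (prefix_indic B k z * prefix_density k z)%:E *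
    (\1_(B k) x * cond (v := loc k) x (fun l => z`_(nb l)))%:E.
  rewrite -EFinM; congr EFin.
  rewrite /prefix_indic /prefix_density !big_ord_recr /= rzk gtn_eqF//.
  rewrite mulrACA; congr (_ * _)%R; last first.
    by congr (_ * cond _ _)%R; apply/funext => l; rewrite rz// nb_lt.
  congr (_ * _)%R; apply: eq_bigr => i _; rewrite rz//; case: ifPn => // i0.
  have iN : (i < N)%N by exact: ltn_trans kN.
  by congr (cond _ _); apply/funext => l; rewrite rz// (ltn_trans (nb_lt l iN)).
under eq_integral do rewrite E.
have c0 x : (0 <= cond (v := loc k) x (fun l => z`_(nb l)))%R.
  exact: nnmp_cond_density_ge0.
rewrite ge0_integralZl_EFin//.
- congr (_ * _); rewrite /nnmp_cond_law [RHS]integral_mkcond.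
  apply: eq_integral => x _; rewrite patchE indicE.
  by case: ifPn; rewrite ?mul1r ?mul0r.
- by move=> x _; rewrite lee_fin mulr_ge0.
- apply/measurable_EFinP/measurable_funM; first exact: measurable_indic.
  exact: measurable_nnmp_cond_density.
- by rewrite mulr_ge0 ?prefix_indic_ge0 ?prefix_density_ge0// ltnW.
Qed.

(** The unconstrained trailing coordinates are integrated out from the end, each contributing total
    mass 1. The induction is on their number [m]. Position 0 is kept since its factor is [p1] rather
    than a mixture. *)
Lemma joint_law_prefix (B : nat -> set R) k : (0 < k <= N)%N ->
  (forall i, measurable (B i)) -> (forall i, (k <= i)%N -> B i = setT) ->
  P [set t | forall i, (i < N)%N -> B i (Z (loc i) t)] =
  iterated_integral k (fun z => (prefix_indic B k z * prefix_density k z)%:E).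
Proof.
move=> kN mB; have [m mE] : exists m, (k + m = N)%N.
  by exists (N - k)%N; rewrite subnKC//; case/andP: kN.
elim: m k kN mE => [|m IH] k kN mE BT.
  rewrite addn0 in mE; rewrite mE.
  have u_uniq : uniq u by case: u u_size => [|x []].
  rewrite -(nnmp_joint_law Z_nnmp u_uniq u_D mB); congr (P _).
  by apply/seteqP; split => t h i; [exact: h|move=> iN;
    exact: (h (Ordinal iN))].
rewrite (IH k.+1); last 3 first.
- by rewrite /= -mE addnS ltnS leq_addr.
- by rewrite addSnnS.
- by move=> i ki; apply: BT; exact: ltnW.
have kN' : (0 < k < N)%N.
  by case/andP: kN => -> _; rewrite -mE -[X in (X < _)%N]addn0 ltn_add2l.
rewrite iterated_integralSr; apply: eq_iterated_integral => z zk.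
have kltN : (k < N)%N by case/andP: kN'.
rewrite prefix_integrate// BT// nnmp_cond_lawT ?mule1//; first exact: loc_D.
by rewrite loc_index//; case/andP: kN.
Qed.

End prefix.

Lemma measurable_before_event k (C : nat -> set R) :
  (forall i, measurable (C i)) ->
  measurable [set t | forall j, (j < k)%N -> C j (Z (s : seq _)`_j t)].
Proof.
move=> mC.
have -> : [set t | forall j, (j < k)%N -> C j (Z (s : seq _)`_j t)] =
    \bigcap_(j in [set j | (j < k)%N]) (Z (s : seq _)`_j @^-1` C j).
  by [].
by apply: bigcap_measurableType => j _; exact: measurable_funPTI.
Qed.

(** * One location given those that precede it *)

Section conditioning.
Variables (v : 'rV[R]_p) (vD : D v) (v_nb : (0 < index v s)%N).
Local Notation k := (index v s).
(** With this choice [v], whether in [s] or not, stands at position [index v s] of [s ++ u], right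
    after all its candidate neighbors; both kinds of location are thus handled at once. *)
Local Notation u := (if v \in s then [::] else [:: v]).

Let u_size : (size u <= 1)%N. Proof. by case: ifP. Qed.

Let u_D x : x \in u -> D x /\ x \notin s.
Proof. by case: ifPn => // vs; rewrite inE => /eqP ->. Qed.

Let kN : (k < n + size u)%N.
Proof.
case: ifPn => vs; first by rewrite /= addn0 -[X in (_ < X)%N](size_tuple s)
  index_mem.
by rewrite /= addn1 ltnS -[X in (_ <= X)%N](size_tuple s) index_size.
Qed.

Let loc_k : (s ++ u)`_k = v.
Proof.
rewrite nth_cat; case: ifPn => [|/negPf]; rewrite index_mem => vs.
  by rewrite nth_index.
by rewrite vs memNindex ?vs// subnn.
Qed.

Let loc_lt j : (j < k)%N -> (s ++ u)`_j = (s : seq _)`_j.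
Proof.
move=> jk; rewrite nth_cat; case: ifPn => //.
by rewrite (leq_trans jk)// index_size.
Qed.

Local Notation dens := (prefix_density u k).

Lemma before_density_ge0 z : (0 <= dens z)%R.
Proof. by apply: prefix_density_ge0 => //; exact: ltnW. Qed.

Lemma joint_lawE (A : set R) (B : nat -> set R) : measurable A ->
  (forall i, measurable (B i)) ->
  P [set t | A (Z v t) /\ forall j, (j < k)%N -> B j (Z (s : seq _)`_j t)] =
  iterated_integral k (fun z => (prefix_indic B k z * dens z)%:E *
    nnmp_cond_law (v := v) A (fun l => z`_(nb l))).
Proof.
move=> mA mB.
(* [A] is inserted at the position of [v], and nothing is required afterwards. *)
pose B' i := if (i < k)%N then B i else if i == k then A else setT.
have mB' i : measurable (B' i) by rewrite /B'; case: ifP => // _; case: ifP.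
have B'k : B' k = A by rewrite /B' ltnn eqxx.
have B'T i : (k.+1 <= i)%N -> B' i = setT.
  by move=> ki; rewrite /B' ltnNge (ltnW ki) gtn_eqF.
transitivity (P [set t | forall i, (i < n + size u)%N -> B' i (Z (s ++ u)`_i
  t)]).
  congr (P _); apply/seteqP; split => t /=.
    move=> [At Bt] i iN; case: (ltngtP i k) => ik.
    - by rewrite /B' ik loc_lt//; exact: Bt.
    - by rewrite B'T.
    - by rewrite ik B'k loc_k.
  move=> h; split; first by have := h k kN; rewrite B'k loc_k.
  move=> j jk; have := h j (ltn_trans jk kN).
  by rewrite /B' jk loc_lt.
rewrite (joint_law_prefix u_size u_D (k := k.+1))// iterated_integralSr.
apply: eq_iterated_integral => z zk.
have kN' : (0 < k < n + size u)%N by rewrite v_nb kN.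
rewrite (prefix_integrate u_size u_D kN' zk (mB' k)) B'k loc_k.
congr (_%:E * _); congr (_ * _)%R.
by apply: eq_bigr => i _; rewrite /B' ltn_ord.
Qed.

Lemma before_lawE (B : nat -> set R) : (forall i, measurable (B i)) ->
  P [set t | forall j, (j < k)%N -> B j (Z (s : seq _)`_j t)] =
  iterated_integral k (fun z => (prefix_indic B k z * dens z)%:E).
Proof.
move=> mB; have := joint_lawE measurableT mB.
under [X in _ = X -> _]eq_iterated_integral do rewrite nnmp_cond_lawT// mule1.
by move=> <-; congr (P _); apply/seteqP; split => t // [].
Qed.

Let nb_k l : (nb (v:=v) l < k)%N.
Proof. exact: nb_before (nb_neighbors vD) l. Qed.

(** Only an inequality, since it rests on superadditivity of lower integrals. [marginal_stationary]
    recovers equality by comparing total masses. *)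
Lemma marginal_ge (A : set R) : measurable A ->
  \sum_l (w (v:=v) l)%:E *
    \int[distribution P (Z (tnth s (nb l)))]_y cond_law (f (v:=v) l) A y
  <= P (Z v @^-1` A).
Proof.
move=> mA.
have cl0 l y := cond_law_ge0 (f_cond vD l) A y.
have w0 l := nnmp_weight_ge0 vD v_nb l.
have -> : P (Z v @^-1` A) = P [set t | A (Z v t) /\
    forall j, (j < k)%N -> (fun=> setT) j (Z (s : seq _)`_j t)].
  by congr (P _); apply/seteqP; split => t // [].
rewrite (joint_lawE (B := fun=> setT))//.
have i1 z : prefix_indic (fun=> setT) k z = 1%R.
  by rewrite /prefix_indic big1// => i _; rewrite indicE in_setT.
apply: (@le_trans _ _ (\sum_l iterated_integral k (fun z =>
    (w (v:=v) l)%:E * ((dens z)%:E * cond_law (f (v:=v) l) A z`_(nb l))))).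
  apply: lee_sum => l _.
  apply: le_trans (iterated_integral_scale_ge _ _) => //; last first.
    by move=> z _; rewrite mule_ge0// lee_fin before_density_ge0.
  rewrite lee_wpmul2l//; first by rewrite lee_fin.
  apply: iterated_integral_marginal_ge => //; first by move=> z _;
    exact: before_density_ge0.
  move=> B mB.
  (* Constraining only the [l]-th neighbor identifies its law as a marginal of the joint density. *)
  pose B' (j : nat) := if j == nb l :> nat then B else setT.
  have mB' j : measurable (B' j) by rewrite /B'; case: ifP.
  transitivity (P [set t | forall j, (j < k)%N -> B' j (Z (s : seq _)`_j t)]).
    congr (P _); apply/seteqP; split => t /=.
      by move=> Bt j jk; rewrite /B'; case: eqP => // ->; rewrite -tnth_nth.
    by move=> /(_ (nb l) (nb_k l)); rewrite /B' eqxx -tnth_nth.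
  rewrite before_lawE//; apply: eq_iterated_integral => z zk.
  congr (_ * _)%:E; rewrite /prefix_indic (bigD1 (Ordinal (nb_k l)))//= /B'
    eqxx.
  rewrite big1 ?mulr1// => i inb; rewrite ifN ?indicE ?in_setT//.
apply: le_trans (iterated_integral_sum_ge _ _) _ => //.
  by move=> l z _; rewrite !mule_ge0 ?lee_fin// before_density_ge0.
apply: le_iterated_integral => z _.
  apply: sume_ge0 => l _.
  by rewrite !mule_ge0 ?lee_fin// before_density_ge0.
rewrite i1 mul1r nnmp_cond_lawE// ge0_sume_distrr//; last first.
  by move=> l _; rewrite mule_ge0// lee_fin.
by apply: lee_sum => l _; rewrite muleCA.
Qed.

(* [B] is shrunk by the exceptional null sets, so that the bound holds at every
   point of the iterated integral. *)
Lemma joint_law_ge (A : set R) (B : nat -> set R)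
    (m : 'I_(nb_size s L v) -> R) :
  measurable A -> (forall i, measurable (B i)) -> (forall l, (0 <= m l)%R) ->
  (forall l, {ae distribution P (Z (tnth s (nb l))), forall y,
     B (nb l) y -> (m l)%:E <= cond_law (f (v:=v) l) A y}) ->
  (\sum_l w (v:=v) l * m l)%:E *
    P [set t | forall j, (j < k)%N -> B j (Z (s : seq _)`_j t)] <=
  P [set t | A (Z v t) /\ forall j, (j < k)%N -> B j (Z (s : seq _)`_j t)].
Proof.
move=> mA mB m0 hB.
have w0 l := nnmp_weight_ge0 vD v_nb l.
have /choice[Nl NlP] : forall l, exists N : set R, [/\ measurable N,
    distribution P (Z (tnth s (nb l))) N = 0 &
    forall y, B (nb l) y -> ~ N y -> (m l)%:E <= cond_law (f (v:=v) l) A y].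
  move=> l; have [N [mN N0 hN]] := hB l; exists N; split => // y By Ny.
  by apply: contrapT => h; apply: Ny; apply: hN => /= /(_ By).
have mNl l : measurable (Nl l) by have [] := NlP l.
pose B' j := B j `\` \bigcup_(l in [set l | nb (v:=v) l = j :> nat]) Nl l.
have mB' j : measurable (B' j).
  by apply: measurableD => //; apply: fin_bigcup_measurable.
have PB' : P [set t | forall j, (j < k)%N -> B j (Z (s : seq _)`_j t)] <=
    P [set t | forall j, (j < k)%N -> B' j (Z (s : seq _)`_j t)].
  apply: le_measure_ae; [exact: measurable_before_event..|].
  have aeN : {ae P, forall t, forall l, ~ Nl l (Z (tnth s (nb l)) t)}.
    apply: filter_forall => l; have [mN N0 _] := NlP l.
    exists (Z (tnth s (nb l)) @^-1` Nl l); split => //.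
      exact: measurable_funPTI.
    by move=> t /contrapT.
  apply: filterS aeN => t Nt Bt j jk; split; first exact: Bt.
  by move=> [l /= lj]; rewrite -lj -tnth_nth; exact: Nt.
apply: (@le_trans _ _ (P [set t | A (Z v t) /\
    forall j, (j < k)%N -> B' j (Z (s : seq _)`_j t)])); last first.
  have mAev (C : nat -> set R) : (forall i, measurable (C i)) ->
      measurable [set t | A (Z v t) /\ forall j, (j < k)%N -> C j (Z (s : seq
        _)`_j t)].
    by move=> mC; apply: measurableI; [exact: measurable_funPTI|exact:
      measurable_before_event].
  apply: le_measure; [exact/mem_set/mAev|exact/mem_set/mAev|].
  by move=> t [At Bt]; split => // j jk; have [] := Bt j jk.
have wm0 : (0 <= \sum_l w (v:=v) l * m l)%R.
  by apply: sumr_ge0 => l _; exact: mulr_ge0.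
apply: le_trans (lee_wpmul2l _ PB') _; first by rewrite lee_fin.
rewrite before_lawE// joint_lawE//.
have F0 z : (0 <= prefix_indic B' k z * dens z)%R.
  by rewrite mulr_ge0 ?prefix_indic_ge0 ?before_density_ge0.
apply: le_trans (iterated_integral_scale_ge _ _) _ => //.
  by move=> z _; rewrite lee_fin.
apply: le_iterated_integral => z zk; first by rewrite mule_ge0 ?lee_fin.
rewrite muleC.
have [Bz|] := pselect (forall j, (j < k)%N -> B' j z`_j); last first.
  rewrite -existsNE => -[j /not_implyP[jk nBj]].
  rewrite /prefix_indic (bigD1 (Ordinal jk))//= indicE memNset//.
  by rewrite !mul0r !mul0e.
rewrite lee_wpmul2l ?lee_fin// nnmp_cond_lawE// -sumEFin; apply: lee_sum => l _.
rewrite EFinM lee_wpmul2l ?lee_fin//; have [_ _] := NlP l; apply.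
  by have [] := Bz _ (nb_k l).
have [_ h] := Bz _ (nb_k l) => Nz; apply: h; exists l => //.
Qed.

End conditioning.

End joint_law.

(** * Distribution functions and quantiles *)

Lemma law_tail_true d (T : measurableType d) (R : realType)
    (P : probability T R) (X : {RV P >-> R}) x :
  distribution P X (tail true x) = (1 - cdf X x)%E.
Proof.
rewrite -(cdf_ccdf_1 X x) (addeC (cdf X x)) addeK//; exact: fin_num_measure.
Qed.

Lemma law_eq_of_cdf d1 d2 (T1 : measurableType d1) (T2 : measurableType d2)
    (R : realType) (P : probability T1 R) (Q : probability T2 R)
    (X : {RV P >-> R}) (Y : {RV Q >-> R}) :
  (forall x, cdf X x = cdf Y x) ->
  forall A, measurable A -> distribution P X A = distribution Q Y A.
Proof.
move=> XY A mA.
apply: (measure_unique (@RGenOInfty.G R) (fun n => `]- n%:R, +oo[%classic) _ _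
  _ _
  (distribution P X) (distribution Q Y)) => //.
- exact: RGenOInfty.measurableE.
- move=> _ _ [x ->] [y ->]; exists (Num.max x y).
  by apply/seteqP; split => z /=; rewrite !in_itv /= !andbT gt_max => /andP.
- by move=> n; exists (- n%:R).
- apply/seteqP; split => // z _; exists (Num.bound `|z|) => //=;
  rewrite in_itv /= andbT ltrNl.
  apply: le_lt_trans (archi_boundP (normr_ge0 z)).
  by rewrite -normrN ler_norm.
- move=> _ [x ->].
  by have := law_tail_true X x; rewrite XY -law_tail_true.
- move=> n; apply: le_lt_trans (ltry 1); apply: probability_le1.
  exact: measurable_itv.
Qed.

Section quantile.
Context d (T : measurableType d) (R : realType) (P : probability T R).
Variable X : {RV P >-> R}.
Local Notation nu := (distribution P X).
Hypothesis nu_atomless : forall x, nu [set x] = 0%E.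

Lemma law_tail_false x : nu (tail false x) = cdf X x.
Proof.
have xx : tail false x `&` [set x] = set0.
  by apply/seteqP; split => // z [zx /= zE]; move: zx; rewrite zE;
    exact: tail_irrefl.
have := measureU nu (measurable_tail false x) (measurable_set1 x) xx.
rewrite [X in (_ + X)%E]nu_atomless adde0 => <-.
by congr (nu _); rewrite /tail setUitv1.
Qed.

Let cdf_fin x : cdf X x = (fine (cdf X x))%:E.
Proof. by rewrite fineK// fin_num_measure. Qed.

(** Before the infimum the distribution function is below [q], after it at least [q]. Continuity of
    the two tails carries both bounds to the infimum itself, where the absence of atoms identifies
    P(X < x) with P(X <= x). *)
Lemma cdf_quantile q : 0 < q < 1 -> cdf X (quantile X q) = q%:E.
Proof.
move=> /andP[q0 q1]; rewrite /quantile; set S := [set x | _].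
have S0 : S !=set0.
  have [M [_ MP]] := cvgr_ge _ (fine_cvg (@cvg_cdfy1 _ _ _ _ X)) _ q1.
  exists (M + 1); rewrite /S/= cdf_fin lee_fin; apply: MP.
  by rewrite ltrDl.
have Slb : has_lbound S.
  have [M [_ MP]] := cvgr_lt _ (fine_cvg (@cvg_cdfNy0 _ _ _ _ X)) _ q0.
  exists M => x; rewrite /S/= cdf_fin lee_fin => qx; rewrite leNgt.
  by apply/negP => /MP/=; rewrite ltNge qx.
apply/eqP; rewrite eq_le; apply/andP; split.
- rewrite -law_tail_false; apply: (@tail_continuous _ _ _ P X false) => // r.
  rewrite tailE => rS; change (nu (tail false (ratr r)) <= q%:E)%E.
  rewrite law_tail_false.
  rewrite leNgt; apply/negP => qr; have : S (ratr r) by exact: ltW.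
  by move=> /(ge_inf Slb); rewrite leNgt rS.
- have : (nu (tail true (inf S)) <= 1 - q%:E)%E.
    apply: (@tail_continuous _ _ _ P X true) => // r.
    rewrite tailE => Sr.
    change (nu (tail true (ratr r)) <= 1 - q%:E)%E; rewrite law_tail_true.
    have [y Sy yr] := inf_lt S0 Sr.
    rewrite leeB//; apply: le_trans Sy _.
    by apply: cdf_nondecreasing; exact: ltW.
  by rewrite law_tail_true cdf_fin -!EFinB !lee_fin lerD2l lerN2.
Qed.

End quantile.

(** * Tail events and limits in the quantile level *)

(* The tail events of the two coefficients: closed on the lower side only. *)
Definition closed_tail (R : realType) (b : bool) (x : R) : set R :=
  if b then [set y | x < y] else [set y | y <= x].

Definition tail_filter (R : realType) (b : bool) : set_system R :=
  if b then at_left 1 else at_right 0.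
Arguments tail_filter : clear implicits.

Section closed_tail.
Context (R : realType).
Implicit Types (b : bool) (x y : R).

Lemma measurable_closed_tail b x : measurable (closed_tail b x).
Proof. by rewrite /closed_tail; case: b; rewrite -set_itvE;
  exact: measurable_itv. Qed.

Lemma closed_tailE b x y : closed_tail b x y = (if b then x < y else y <= x).
Proof. by case: b. Qed.

Lemma tail_closed_tail b x y : tail b x y -> closed_tail b x y.
Proof. by rewrite tailE closed_tailE; case: b => //; exact: ltW. Qed.

Lemma closed_tail_neq b x y : closed_tail b x y -> y <> x -> tail b x y.
Proof.
rewrite tailE closed_tailE; case: b => // yx /eqP xy.
by rewrite lt_neqAle xy.
Qed.

Global Instance tail_filter_proper b : ProperFilter (tail_filter R b).
Proof. by rewrite /tail_filter; case: b; [exact: at_left_proper_filter|exact: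
  at_right_proper_filter]. Qed.

(** Both limits are parametrised by the mass [a] of the tail, with level [1 - a] for the upper one
    and [a] for the lower one; [e <= 1] keeps the level inside (0, 1). *)
Lemma near_tail_filter b (Q : R -> Prop) :
  (\forall q \near tail_filter R b, Q q) ->
  exists e, [/\ 0 < e, e <= 1 &
    forall a, 0 < a < e -> Q (if b then 1 - a else a)].
Proof.
have H (e : R) : 0 < e -> 0 < Num.min e 1 <= 1.
  by move=> e0; rewrite lt_min e0 ltr01 ge_min lexx orbT.
case: b => -[e /= e0 he]; exists (Num.min e 1); have /andP[m0 m1] := H e e0;
  split => // a /andP[a0]; rewrite lt_min => /andP[ae a1]; apply: he => //=.
- by rewrite opprB addrC subrK gtr0_norm.
- by rewrite gtrBl.
- by rewrite sub0r normrN gtr0_norm.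
Qed.

Lemma tail_filter_near b e : 0 < e ->
  \forall q \near tail_filter R b, exists2 a : R, 0 < a < e & q = if b then 1 -
    a else a.
Proof.
move=> e0; case: b; exists e => //= q; rewrite /ball_ /=.
  move=> qe q1; exists (1 - q); last by rewrite opprB addrC subrK.
  by rewrite subr_gt0 q1 (le_lt_trans (ler_norm _) qe).
rewrite sub0r normrN => qe q0; exists q => //.
by rewrite q0 (le_lt_trans (ler_norm _) qe).
Qed.

Lemma cvg_sumr (T : Type) (F : set_system T) (I : Type) (r : seq I)
    (g : I -> T -> R) (a : I -> R) : Filter F ->
  (forall i, g i t @[t --> F] --> a i) ->
  \sum_(i <- r) g i t @[t --> F] --> \sum_(i <- r) a i.
Proof.
move=> FF ga; elim: r => [|i r IH].
  by under eq_fun do rewrite big_nil; rewrite big_nil; exact: cvg_cst.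
under eq_fun do rewrite big_cons; rewrite big_cons.
exact: cvgD.
Qed.

End closed_tail.

Lemma ae_eq_measure d (T : measurableType d) (R : realType)
    (m1 m2 : {measure set T -> \bar R}) (Q : T -> Prop) :
  (forall A, measurable A -> m1 A = m2 A) ->
  {ae m1, forall x, Q x} -> {ae m2, forall x, Q x}.
Proof. by move=> m12 [N [mN N0 QN]]; exists N; split; rewrite -?m12. Qed.

(** * The common marginal law of the process *)

Section stationary.
Local Open Scope ereal_scope.
Context (R : realType) (p n L : nat) (D : set 'rV[R]_p) (s : n.-tuple 'rV[R]_p).
Variable nb : forall v : 'rV[R]_p, 'I_(nb_size s L v) -> 'I_n.
Variable w : forall v : 'rV[R]_p, 'I_(nb_size s L v) -> R.
Variable f : forall v : 'rV[R]_p, 'I_(nb_size s L v) -> R -> R -> R.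
Variable mu : forall v : 'rV[R]_p, 'I_(nb_size s L v) ->
  probability (R * R)%type R.
Variable p1 : R -> R.
Context d (Omega : measurableType d) (P : probability Omega R).
Variable Z : 'rV[R]_p -> {RV P >-> R}.
Hypothesis s_uniq : uniq s.
Hypothesis s_D : forall j, D (tnth s j).
Hypothesis nb_neighbors : forall v, D v -> is_neighbor_list s v (@nb v).
Hypothesis f_cond : forall v, D v -> forall l, is_cond_density (mu l) (@f v l).
Hypothesis mu_ok : forall v, D v -> forall l, base_vector_properties (@mu v l).
Hypothesis Z_nnmp : is_nnmp D nb w f p1 Z.
Hypothesis V_marginal : forall v, D v ->
  forall (l : 'I_(nb_size s L v)) (x : R),
  cdf (Vcoord (mu l)) x = cdf (Z (tnth s (nb l))) x.
Hypothesis n_gt0 : (0 < n)%N.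

Local Notation nu := (distribution P (Z (s : seq _)`_0)).

Let mZ u (A : set R) : measurable A -> measurable (Z u @^-1` A).
Proof. by move=> mA; rewrite -[_ @^-1` _]setTI; exact: measurable_funP. Qed.

Lemma marginal_V_neighbor v (vD : D v) l A : measurable A ->
  distribution (@mu v l) (Vcoord (mu l)) A = distribution P (Z (tnth s (nb l)))
    A.
Proof. exact: law_eq_of_cdf (V_marginal vD l) A. Qed.

(** Strong induction on [index v s], which is smaller for the neighbors of [v]. Each V has the law
    of a neighbor, hence [nu], and so has each U by exchangeability; the mixture bound [marginal_ge]
    then says that the law of Z(v) dominates [nu]. *)
Lemma marginal_stationary v A : D v -> measurable A -> distribution P (Z v) A =
  nu A.
Proof.
have [i iv] := ubnP (index v s); elim: i v iv A => // i IH v iv A vD mA.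
have [v0|v_gt0] := posnP (index v s).
  have vs : v \in s by rewrite -index_mem v0 size_tuple.
  by rewrite -{1}(nth_index 0%R vs) v0.
have nbE l B : measurable B ->
    distribution P (Z (tnth s (nb (v:=v) l))) B = nu B.
  move=> mB; apply: IH => //; rewrite (tnth_nth 0%R) index_uniq ?size_tuple//.
  exact: leq_trans (nb_before (nb_neighbors vD) l) iv.
have ge B : measurable B -> nu B <= distribution P (Z v) B.
  move=> mB; have := marginal_ge s_uniq s_D nb_neighbors f_cond Z_nnmp vD v_gt0
    mB.
  apply: le_trans; rewrite -[leLHS]mul1e -(congr1 EFin (nnmp_weight_sum1 Z_nnmp
    vD v_gt0)).
  rewrite -sumEFin ge0_sume_distrl; last first.
    by move=> l _; rewrite lee_fin (nnmp_weight_ge0 Z_nnmp vD v_gt0).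
  apply: lee_sum => l _; rewrite lee_wpmul2l ?lee_fin ?(nnmp_weight_ge0 Z_nnmp
    vD v_gt0)//.
  rewrite (@eq_measure_integral _ _ _ _ (distribution (mu l) (Vcoord (mu l))));
    last first.
    by move=> C mC _; exact/esym/marginal_V_neighbor.
  rewrite -(cond_density_law (f_cond vD l))// (marginal_UE (mu_ok vD l))//.
  by rewrite marginal_V_neighbor// nbE.
(* Domination on the complement gives the reverse inequality, both laws being probabilities. *)
apply/eqP; rewrite eq_le ge// andbT.
have := ge _ (measurableC mA); rewrite !probability_setC//.
have fin X : X \is a fin_num -> forall Y, Y \is a fin_num ->
    (1 - X <= 1 - Y :> \bar R) = (Y <= X).
  by case: X => // x _ [y| |] // _; rewrite -!EFinB !lee_fin lerD2l lerN2.
by rewrite fin// fin_num_measure.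
Qed.

(** * The tail inequality at one location *)

Section tail_of_location.
Variables (v : 'rV[R]_p) (vD : D v) (v_nb : (0 < index v s)%N).

Lemma marginal_V_stationary v' (vD' : D v') l A : measurable A ->
  distribution (@mu v' l) (Vcoord (mu l)) A = nu A.
Proof. by move=> mA; rewrite marginal_V_neighbor// marginal_stationary. Qed.

Let l0 : 'I_(nb_size s L v).
Proof.
have [l _|no] := pickP 'I_(nb_size s L v); first exact: l.
have /eqP := nnmp_weight_sum1 Z_nnmp vD v_nb.
by rewrite big1 ?(eq_sym 0%R) ?oner_eq0// => l; have := no l.
Qed.

Lemma stationary_atomless x : nu [set x] = 0.
Proof.
by rewrite -(marginal_V_stationary vD l0)// (marginal_V_atomless (f_cond vD l0)
  (mu_ok vD l0)).
Qed.

Local Notation xq := (quantile (Z (s : seq _)`_0)).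

Lemma law_tail_quantile b (a : R) : (0 < a < 1)%R ->
  nu (tail b (xq (if b then 1 - a else a)%R)) = a%:E.
Proof.
move=> /andP[a0 a1]; case: b.
  rewrite law_tail_true (cdf_quantile stationary_atomless).
    by rewrite -EFinB; congr EFin; rewrite opprB addrC subrK.
  by rewrite subr_gt0 a1 gtrBl a0.
by rewrite (law_tail_false stationary_atomless) (cdf_quantile
  stationary_atomless) ?a0.
Qed.

Lemma le_law_tail b x y : tail b x y -> nu (tail b y) <= nu (tail b x).
Proof.
have mt z : (tail b z : set R) \in measurable by apply: mem_set;
  exact: measurable_tail.
move=> xy; apply: le_measure; [exact: mt|exact: mt|].
by move=> z; exact: tail_trans.
Qed.

Lemma tail_halve b c : 0 < nu (tail b c) ->
  exists c', tail b c c' /\ 0 < nu (tail b c') < nu (tail b c).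
Proof.
move=> c0; pose a := fine (nu (tail b c)).
have aE : nu (tail b c) = a%:E by rewrite fineK// fin_num_measure//;
  exact: measurable_tail.
have a0 : (0 < a)%R by rewrite -lte_fin -aE.
have a1 : (a <= 1)%R by rewrite -lee_fin -aE probability_le1//;
  exact: measurable_tail.
have a2 : (0 < a / 2 < 1)%R.
  by rewrite divr_gt0//= ltr_pdivrMr// mul1r (le_lt_trans a1)// ltr1n.
(* [c'] is the quantile whose tail has half the mass of the tail at [c]. *)
have := law_tail_quantile b a2; set c' := xq _ => c'E.
have lt : nu (tail b c') < nu (tail b c).
  by rewrite c'E aE lte_fin ltr_pdivrMr// ltr_pMr// ltr1n.
exists c'; split; last by rewrite lt c'E lte_fin divr_gt0.
have [//|cc'|/le_law_tail] := tail_total b c c';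
  first by rewrite cc' ltxx in lt.
by rewrite leNgt lt.
Qed.

(** Induction on the number of locations. If the earlier ones lie in a strictly smaller tail, at
    [c'], then the next one lies in the tail at [c] with conditional probability at least the
    difference [e] of the two masses. *)
Lemma before_tail_gt0 b i c : (i <= n)%N -> 0 < nu (tail b c) ->
  0 < P [set t | forall j, (j < i)%N -> tail b c (Z (s : seq _)`_j t)].
Proof.
have mt (x : R) : measurable (tail b x) by exact: measurable_tail.
have mev k (x : R) : measurable [set t | forall j, (j < k)%N -> tail b x (Z (s
  : seq _)`_j t)].
  exact: (measurable_before_event s Z _ (C := fun=> tail b x)).
elim: i c => [|i IH] c ni c0.
  rewrite (_ : [set t | _] = setT) ?probability_setT ?lte01//.
  by apply/seteqP; split.
have [i0|i_gt0] := posnP i.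
  have {}c0 : 0 < P (Z (s : seq _)`_0 @^-1` tail b c) by exact: c0.
  apply: lt_le_trans c0 _; apply: le_measure.
  - apply: mem_set; exact: mZ.
  - by apply: mem_set; exact: mev.
  - by move=> t h j; rewrite i0 ltnS leqn0 => /eqP ->.
have [c' [cc' /andP[c'0 c'c]]] := tail_halve c0.
pose v' := (s : seq _)`_i.
have v'E : v' = tnth s (Ordinal ni) by rewrite (tnth_nth 0%R).
have vD' : D v' by rewrite v'E.
have v'i : index v' s = i by rewrite index_uniq// size_tuple.
have v'_nb : (0 < index v' s)%N by rewrite v'i.
have /choice[m mP] := fun l => tail_threshold (f_cond vD' l) (mu_ok vD' l) b c
  c'.
pose e := fine (nu (tail b c) - nu (tail b c')).
have finT (x : R) : nu (tail b x) \is a fin_num by apply: fin_num_measure;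
  exact: mt.
have eE : e%:E = nu (tail b c) - nu (tail b c') by rewrite fineK// fin_numB
  (finT c) (finT c').
have e0 : (0 < e)%R by rewrite -lte_fin eE sube_gt0.
(* The event that U is in the tail at [c] has mass [nu (tail b c)]. The part with V outside the tail
   at [c'] has mass at most [m l], the rest at most [nu (tail b c')]. *)
have me l : (e <= m l)%R.
  have [m0 mub _] := mP l.
  have mtC : measurable (~` tail b c') by exact: (measurableC (mt c')).
  rewrite -lee_fin eE leeBlDr//.
  rewrite -(marginal_V_stationary vD' l (mt c)) -(marginal_UE (mu_ok vD' l) (mt
    c)).
  have mcl := measurable_cond_law (f_cond vD' l) (mt c).
  have mX (A : set R) : measurable A -> measurable (tail b c `*` A).
    by move=> mA; exact: (measurableX (mt c) mA).
  have -> : (tail b c `*` [set: R]) =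
      (tail b c `*` ~` tail b c') `|` (tail b c `*` tail b c').
    apply/seteqP; split => [z [zc _]|z [[zc _]|[zc _]]]; [|by split|by split].
    by have [zc'|zc'] := pselect (tail b c' z.2); [right|left].
  apply: le_trans (measureU2 (mu l) (mX _ mtC) (mX _ (mt c'))) _; apply: leeD.
    change (mu l (tail b c `*` ~` tail b c') <= (m l)%:E).
    rewrite (cond_density_law (f_cond vD' l))//.
    apply: (@le_trans _ _ ((m l)%:E * distribution (mu l) (Vcoord (mu l)) (~`
      tail b c'))).
      rewrite -integral_cst//; apply: ae_ge0_le_integral => //.
      - by move=> y _; exact: cond_law_ge0 (f_cond vD' l) _ _.
      - apply: measurable_funTS; exact: mcl.
    by rewrite -[leRHS]mule1 lee_wpmul2l ?lee_fin// probability_le1.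
  rewrite -(marginal_V_stationary vD' l (mt c')) (marginal_VE _ (mt c')).
  apply: le_measure; [by apply: mem_set; exact: mX|by apply: mem_set;
    exact: (measurableX measurableT (mt c'))|].
  by move=> z [_ ?].
pose B j := if (j < i)%N then tail b c' else setT.
have mB j : measurable (B j) by rewrite /B; case: ifP.
have hB l : {ae distribution P (Z (tnth s (nb (v:=v') l))), forall y,
    B (nb l) y -> (m l)%:E <= cond_law (f (v:=v') l) (tail b c) y}.
  have [_ _ mlb] := mP l.
  apply: ae_eq_measure (fun A => @marginal_V_neighbor _ vD' l A) _.
  apply: filterS mlb => y yc Bc; apply: yc; move: Bc; rewrite /B.
  by rewrite -v'i (nb_before (nb_neighbors vD') l).
have m0 l : (0 <= m l)%R by have [] := mP l.
have := joint_law_ge s_uniq s_D nb_neighbors f_cond Z_nnmp vD' v'_nb (mt c) mB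
  m0 hB.
rewrite v'i => jl.
apply: lt_le_trans (le_trans jl _).
  apply: mule_gt0.
    rewrite lte_fin (lt_le_trans e0)//.
    rewrite -[leLHS]mul1r -(nnmp_weight_sum1 Z_nnmp vD' v'_nb) mulr_suml.
    by apply: ler_sum => l _; rewrite ler_wpM2l ?me// (nnmp_weight_ge0 Z_nnmp
      vD' v'_nb).
  apply: lt_le_trans (IH c' (ltnW ni) c'0) _.
  apply: le_measure; [by apply: mem_set; exact: mev|by apply: mem_set;
    exact: measurable_before_event|].
  by move=> t h j ji; rewrite /B ji; exact: h.
apply: le_measure.
- apply: mem_set; apply: measurableI; first exact: mZ.
  exact: measurable_before_event.
- by apply: mem_set; exact: mev.
- move=> t [tv h] j; rewrite ltnS leq_eqVlt => /predU1P[->//|ji].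
  by have := h j ji; rewrite /B ji; exact: tail_trans.
Qed.

Local Notation nbs A := [set t | forall l, A (Z (tnth s (nb (v:=v) l)) t)].

Lemma measurable_neighbors_event (A : set R) : measurable A -> measurable (nbs
  A).
Proof.
move=> mA; have -> : nbs A = \bigcap_(l in setT) (Z (tnth s (nb (v:=v) l))
  @^-1` A).
  by apply/seteqP; split => t h l; [move=> _; exact: h|exact: h l I].
by apply: fin_bigcap_measurable => // l _; exact: mZ.
Qed.

(** All Z share the law [nu], so null changes of [A] alter the events only by null sets. This serves
    to pass from closed to open tails and between thresholds of equal tail mass. *)
Lemma cond_prob_congr (A A' : set R) : measurable A -> measurable A' ->
  nu (A `\` A') = 0 -> nu (A' `\` A) = 0 ->
  cond_prob P [set t | A (Z v t)] (nbs A) =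
  cond_prob P [set t | A' (Z v t)] (nbs A').
Proof.
have ae_sub (C C' : set R) u : D u -> measurable C -> measurable C' -> nu (C
  `\` C') = 0 ->
    {ae P, forall t, C (Z u t) -> C' (Z u t)}.
  move=> uD mC mC' C0; have mCC' : measurable (C `\` C') by exact: measurableD.
  exists (Z u @^-1` (C `\` C')); split; first exact: mZ.
    by rewrite -C0 -(marginal_stationary uD mCC').
  by move=> t /not_implyP.
have le (C C' : set R) : measurable C -> measurable C' -> nu (C `\` C') = 0 ->
    P (nbs C) <= P (nbs C') /\
    P ([set t | C (Z v t)] `&` nbs C) <= P ([set t | C' (Z v t)] `&` nbs C').
  move=> mC mC' C0.
  have aen : {ae P, forall t l, C (Z (tnth s (nb (v:=v) l)) t) ->
      C' (Z (tnth s (nb (v:=v) l)) t)}.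
    by apply: filter_forall => l; exact: ae_sub.
  split; apply: le_measure_ae.
  - exact: measurable_neighbors_event.
  - exact: measurable_neighbors_event.
  - by apply: filterS aen => t h Ct l; exact/h/Ct.
  - by apply: measurableI; [exact: mZ|exact: measurable_neighbors_event].
  - by apply: measurableI; [exact: mZ|exact: measurable_neighbors_event].
  - apply: filterS2 aen (ae_sub C C' v vD mC mC' C0) => t h hv [Cv Ct].
    by split; [exact: hv|move=> l; exact/h/Ct].
move=> mA mA' n1 n2; have [le1 le2] := le _ _ mA mA' n1;
  have [le3 le4] := le _ _ mA' mA n2.
by rewrite /cond_prob; congr (fine _ / fine _)%R; apply/eqP;
  rewrite eq_le ?le1 ?le2 ?le3 ?le4.
Qed.

Lemma neighbors_tail_gt0 b x : 0 < nu (tail b x) -> 0 < P (nbs (tail b x)).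
Proof.
move=> x0; apply: lt_le_trans (before_tail_gt0 (leqnn n) x0) _.
have mt : measurable (tail b x) by exact: measurable_tail.
apply: le_measure.
- apply: mem_set; exact: (measurable_before_event s Z _ (C := fun=> tail b x)).
- apply: mem_set; exact: measurable_neighbors_event.
- by move=> t h l; rewrite (tnth_nth 0%R); exact: h.
Qed.

(** The thresholds [m l] of the kernels at [x] link the two sides: their mixture is at most the
    conditional probability by [joint_law_ge], and they dominate the kernels outside the tail. *)
Lemma cond_law_le_cond_prob b x (c : R) : 0 < nu (tail b x) ->
  (cond_prob P [set t | tail b x (Z v t)] (nbs (tail b x)) <= c)%R ->
  {ae nu, forall y, ~ tail b x y ->
    nnmp_cond_law w f (v := v) (tail b x) (fun=> y) <= c%:E}.
Proof.
move=> x0 cpc; have mt : measurable (tail b x) by exact: measurable_tail.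
have /choice[m mP] := fun l => tail_threshold (f_cond vD l) (mu_ok vD l) b x x.
have w0 l := nnmp_weight_ge0 Z_nnmp vD v_nb l.
have m0 l : (0 <= m l)%R by have [] := mP l.
(* Only positions of actual neighbors are constrained, so that the conditioning event is the one of
   the tail coefficient. *)
pose B j := if `[< exists l, nb (v:=v) l = j :> nat >] then tail b x else setT.
have mB j : measurable (B j) by rewrite /B; case: ifP.
have Bnb l : B (nb (v:=v) l) = tail b x.
  by rewrite /B; case: ifPn => // /asboolPn; case; exists l.
have hB l : {ae distribution P (Z (tnth s (nb (v:=v) l))), forall y,
    B (nb l) y -> (m l)%:E <= cond_law (f (v:=v) l) (tail b x) y}.
  have [_ _ mlb] := mP l; rewrite Bnb.
  exact: ae_eq_measure (fun A => @marginal_V_neighbor _ vD l A) mlb.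
have nbsE : [set t | forall j, (j < index v s)%N -> B j (Z (s : seq _)`_j t)] =
    nbs (tail b x).
  apply/seteqP; split => t h.
    move=> l; have := h _ (nb_before (nb_neighbors vD) l).
    by rewrite Bnb (tnth_nth 0%R).
  move=> j _; rewrite /B; case: ifPn => // /asboolP[l <-].
  by have := h l; rewrite (tnth_nth 0%R).
have := joint_law_ge s_uniq s_D nb_neighbors f_cond Z_nnmp vD v_nb mt mB m0 hB.
have -> : [set t | tail b x (Z v t) /\
    forall j, (j < index v s)%N -> B j (Z (s : seq _)`_j t)] =
    [set t | tail b x (Z v t)] `&` nbs (tail b x) by rewrite -nbsE.
rewrite nbsE => jl.
have mn := measurable_neighbors_event mt.
have mvn : measurable ([set t | tail b x (Z v t)] `&` nbs (tail b x)).
  by apply: measurableI => //; exact: mZ.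
have Mc : (\sum_l w (v:=v) l * m l <= c)%R.
  apply: le_trans cpc; rewrite /cond_prob ler_pdivlMr; last first.
    by rewrite fine_gt0// neighbors_tail_gt0//= (le_lt_trans (probability_le1 _
      mn))// ltry.
  by rewrite -lee_fin EFinM !fineK// fin_num_measure.
have aem : {ae nu, forall y l, ~ tail b x y ->
    cond_law (f (v:=v) l) (tail b x) y <= (m l)%:E}.
  apply: filter_forall => l; have [_ mub _] := mP l.
  exact: ae_eq_measure (fun A => @marginal_V_stationary _ vD l A) mub.
apply: filterS aem => y h xy; rewrite (nnmp_cond_lawE f_cond Z_nnmp vD v_nb)//.
apply: (@le_trans _ _ (\sum_l w (v:=v) l * m l)%:E); last by rewrite lee_fin.
rewrite -sumEFin; apply: lee_sum => l _.
by rewrite EFinM lee_wpmul2l ?lee_fin//; exact: h.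
Qed.

(** Covers thresholds beyond which [nu] has no mass, where conditioning says nothing: each kernel is
    nonnegative with integral 0. *)
Lemma null_tail_cond_law b x : nu (tail b x) = 0 ->
  {ae nu, forall y, nnmp_cond_law w f (v := v) (tail b x) (fun=> y) = 0}.
Proof.
move=> x0; have mt : measurable (tail b x) by exact: measurable_tail.
have ae0 : {ae nu, forall y l, cond_law (f (v:=v) l) (tail b x) y = 0}.
  apply: filter_forall => l.
  apply: ae_eq_measure (fun A => @marginal_V_stationary _ vD l A) _.
  have mc := measurable_cond_law (f_cond vD l) mt.
  have c0 y := cond_law_ge0 (f_cond vD l) (tail b x) y.
  have [/(_ _)+ _] := ae_eq_integral_abs (distribution (mu l) (Vcoord (mu l)))
    measurableT mc.
  under eq_integral => y _ do rewrite gee0_abs//.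
  rewrite -(cond_density_law (f_cond vD l))// (marginal_UE (mu_ok vD l))//.
  rewrite marginal_V_stationary// => /(_ x0).
  by apply: filterS => y /(_ I).
apply: filterS ae0 => y h; rewrite (nnmp_cond_lawE f_cond Z_nnmp vD v_nb)//.
by rewrite big1// => l _; rewrite h mule0.
Qed.

(** Passage from a fixed threshold to one that moves with [y]. For rational [r] further out than
    [y], the point [y] lies outside the tail at [r], so the bound at [r] holds for almost every such
    [y]; the exceptional sets are countably many, and [r] then tends to [y]. *)
Lemma diagonal_cond_law_le b (c : R) (e : \bar R) : (0 <= c)%R ->
  (forall x, 0 < nu (tail b x) < e ->
    (cond_prob P [set t | tail b x (Z v t)] (nbs (tail b x)) <= c)%R) ->
  {ae nu, forall y, nu (tail b y) < e ->
    nnmp_cond_law w f (v := v) (tail b y) (fun=> y) <= c%:E}.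
Proof.
move=> c0 hc.
pose Q (r : rat) y := tail b y (ratr r) -> nu (tail b y) < e ->
  nnmp_cond_law w f (v := v) (tail b (ratr r)) (fun=> y) <= c%:E.
have aeQ r : {ae nu, forall y, Q r y}.
  have [x0|x_neq0] := eqVneq (nu (tail b (ratr r))) 0.
    by apply: filterS (null_tail_cond_law x0) => y h _ _; rewrite h lee_fin.
  have x0 : 0 < nu (tail b (ratr r)) by rewrite lt_neqAle eq_sym x_neq0
    measure_ge0.
  have [xe|ex] := ltP (nu (tail b (ratr r))) e.
    apply: filterS (cond_law_le_cond_prob x0 (hc _ _)); last by rewrite x0.
    by move=> y h yr _; apply: h => /tail_asym.
  (* This case is void: the tail at [y] contains that at [r] and so has mass at least [e]. *)
  apply: aeW => y yr ye; have := lt_le_trans ye ex.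
  by rewrite ltNge le_law_tail.
have : {ae nu, forall (y : R) (k : nat) (r : rat),
    choice.unpickle k = Some r -> Q r y}.
  apply: ae_foralln => k; case: (choice.unpickle k) => [r|]; last exact: aeW.
  by apply: filterS (aeQ r) => y Qy _ [<-].
apply: filterS => y h ye.
(* For fixed [y] the mixture of kernels is a measure, to which [tail_continuous] applies. *)
pose m := density_measure (@lebesgue_measure R)
  (fun z => nnmp_cond_density_ge0 f_cond Z_nnmp vD v_nb z (fun=> y))
  (measurable_nnmp_cond_density w f_cond vD (fun=> y)).
apply: (@tail_continuous _ _ _ m idfun).
  by move=> _ A mA; rewrite setTI; exact: mA.
by move=> r yr; exact: (h (choice.pickle r) r (choice.pickleK r) yr ye).
Qed.

Lemma sum_tail_square_le b x (c : R) (e : \bar R) : (0 <= c)%R ->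
  (forall x, 0 < nu (tail b x) < e ->
    (cond_prob P [set t | tail b x (Z v t)] (nbs (tail b x)) <= c)%R) ->
  nu (tail b x) < e ->
  \sum_l (w (v:=v) l)%:E * mu l (tail b x `*` tail b x) <=
  2%:E * (c%:E * nu (tail b x)).
Proof.
move=> c0 hc xe; have mt (y : R) : measurable (tail b y) by exact:
  measurable_tail.
have w0 l := nnmp_weight_ge0 Z_nnmp vD v_nb l.
have cl0 l y := cond_law_ge0 (f_cond vD l) (tail b y) y.
have md l := measurable_diag_cond_law (f_cond vD l) b.
have E l : (w (v:=v) l)%:E * mu l (tail b x `*` tail b x) = 2%:E *
    \int[nu]_(y in tail b x) ((w (v:=v) l)%:E * cond_law (f (v:=v) l) (tail b
      y) y).
  rewrite (tail_diagonal (f_cond vD l) (mu_ok vD l)) muleCA.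
  rewrite ge0_integralZl_EFin//; last by apply: measurable_funTS; exact: md.
  congr (_ * (_ * _)); apply: eq_measure_integral => A mA _.
  exact/marginal_V_stationary.
under eq_bigr do rewrite E.
rewrite -ge0_sume_distrr; last first.
  by move=> l _; apply: integral_ge0 => y _; rewrite mule_ge0 ?lee_fin.
rewrite lee_wpmul2l// -ge0_integral_sum//; last 2 first.
- move=> l; apply: measurable_funTS; apply: emeasurable_funM => //; exact: md.
- by move=> l y _; rewrite mule_ge0 ?lee_fin.
rewrite -integral_cst//; apply: ae_ge0_le_integral => //.
- by move=> y _; apply: sume_ge0 => l _; rewrite mule_ge0 ?lee_fin.
- apply: measurable_funTS; apply: emeasurable_sum => l.
  by apply: emeasurable_funM => //; exact: md.
- apply: filterS (diagonal_cond_law_le c0 hc) => y h xy.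
  rewrite -(nnmp_cond_lawE f_cond Z_nnmp vD v_nb (fun=> y) (mt y)).
  by apply: h; apply: le_lt_trans xe; exact: le_law_tail.
Qed.

(** One tail contains the other. The distribution function may be flat between [x] and [y], so a
    threshold need not be the quantile of its level. *)
Lemma law_tailD_null b x y : nu (tail b x) = nu (tail b y) ->
  nu (tail b x `\` tail b y) = 0.
Proof.
have mt (z : R) : measurable (tail b z) by exact: measurable_tail.
move=> xy; have [txy|->|tyx] := tail_total b x y.
- have yx : tail b x `&` tail b y = tail b y.
    by apply: setIidr => z; exact: tail_trans.
  have fin : nu (tail b y) \is a fin_num by apply: fin_num_measure; exact: mt.
  have muD : nu (tail b x `\` tail b y) = nu (tail b x) - nu (tail b x `&` tail
    b y).
    apply: measureD => //; apply: (le_lt_trans (probability_le1 _ (mt x))).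
    exact: ltry.
  by rewrite muD yx xy subee.
- by rewrite setDv measure0.
- rewrite (_ : _ `\` _ = set0) ?measure0//.
  by apply/seteqP; split => // z [zx]; case; exact: tail_trans zx.
Qed.

Lemma closed_tail_congr b x : [/\ measurable (closed_tail b x),
  nu (closed_tail b x `\` tail b x) = 0 & nu (tail b x `\` closed_tail b x) =
    0].
Proof.
have mt : measurable (tail b x) by exact: measurable_tail.
have mc : measurable (closed_tail b x) by exact: measurable_closed_tail.
split=> //.
  apply/eqP; rewrite eq_le measure_ge0 andbT -(stationary_atomless x).
  apply: le_measure.
  - by apply: mem_set; exact: measurableD.
  - by apply: mem_set; exact: measurable_set1.
  - by move=> y [cy ty]; apply: contrapT => yx; apply: ty;
    exact: closed_tail_neq cy yx.
rewrite (_ : _ `\` _ = set0) ?measure0//.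
by apply/seteqP; split => // y [ty]; case; exact: tail_closed_tail.
Qed.

Lemma component_cond_probE l b x :
  cond_prob (@mu v l) [set z | closed_tail b x z.1]
    [set z | forall _ : 'I_1, closed_tail b x z.2] =
  (fine (mu l (tail b x `*` tail b x)) / fine (nu (tail b x)))%R.
Proof.
have mt : measurable (tail b x) by exact: measurable_tail.
have [mc _ _] := closed_tail_congr b x.
have c0 : nu (closed_tail b x `\` tail b x) = 0 by have [] := closed_tail_congr
  b x.
have mD : measurable (closed_tail b x `\` tail b x) by exact: measurableD.
have cB : [set z : R * R | forall _ : 'I_1, closed_tail b x z.2] = setT `*`
  closed_tail b x.
  by apply/seteqP; split => [z h|z [_ h] _//]; split => //; exact: (h ord0).
have cAB : [set z : R * R | closed_tail b x z.1] `&` (setT `*` closed_tail b x)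
  =
    closed_tail b x `*` closed_tail b x.
  by apply/seteqP; split => z [] // ? [].
rewrite /cond_prob cB cAB.
have -> : mu l (setT `*` closed_tail b x) = nu (tail b x).
  rewrite -marginal_VE// (marginal_V_stationary vD l mc).
  have ctE : closed_tail b x `&` tail b x = tail b x.
    by apply: setIidr => z; exact: tail_closed_tail.
  have muDI : nu (closed_tail b x) =
      nu (closed_tail b x `\` tail b x) + nu (closed_tail b x `&` tail b x).
    exact: measureDI.
  by rewrite muDI c0 add0e ctE.
have -> // : mu l (closed_tail b x `*` closed_tail b x) = mu l (tail b x `*`
  tail b x).
apply/eqP; rewrite eq_le; apply/andP; split; last first.
  apply: le_measure; [by apply: mem_set; exact: measurableX|by apply: mem_set;
    exact: measurableX|].
  by move=> z [z1 z2]; split; exact: tail_closed_tail.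
apply: le_measure_ae; [exact: measurableX|exact: measurableX|].
(* The two squares differ only where some coordinate lies in the null difference of the tails. *)
exists (((closed_tail b x `\` tail b x) `*` setT) `|` (setT `*` (closed_tail b
  x `\` tail b x))).
have mDT : measurable ((closed_tail b x `\` tail b x) `*` [set: R]) by exact:
  measurableX.
have mTD : measurable ([set: R] `*` (closed_tail b x `\` tail b x)) by exact:
  measurableX.
split; first exact: measurableU.
  apply/eqP; rewrite eq_le measure_ge0 andbT.
  apply: le_trans (measureU2 (mu l) mDT mTD) _.
  have -> : (mu l : {content set _ -> \bar R}) ((closed_tail b x `\` tail b x)
    `*` [set: R]) = 0.
    by apply: etrans c0; apply: etrans (marginal_UE (mu_ok vD l) mD) _;
      exact: marginal_V_stationary.
  rewrite add0e.
  have -> : (mu l : {content set _ -> \bar R}) ([set: R] `*` (closed_tail b x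
    `\` tail b x)) = 0.
    by apply: etrans c0; apply: etrans (esym (marginal_VE (mu l) mD)) _;
      exact: marginal_V_stationary.
  by [].
move=> z /not_implyP[[z1 z2] zt].
have [t1|t1] := pselect (tail b x z.1); [right|by left].
by split => //; split => // t2; apply: zt.
Qed.

(** By contradiction, with [c] strictly between [lam] and the weighted sum [S]. Far in the tail the
    conditional probability is at most [c], hence so is the weighted sum of the component quotients
    divided by 2, and in the limit [S <= c]. *)
Lemma tail_dependence_ge b (lam : R) (lam_ : 'I_(nb_size s L v) -> R) :
  cond_prob P [set t | closed_tail b (xq q) (Z v t)] (nbs (closed_tail b (xq
    q)))
    @[q --> tail_filter R b] --> lam ->
  (forall l, cond_prob (mu l) [set z | closed_tail b (xq q) z.1]
      [set z | forall _ : 'I_1, closed_tail b (xq q) z.2]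
    @[q --> tail_filter R b] --> lam_ l) ->
  (\sum_(l < nb_size s L v) w l * lam_ l / 2 <= lam)%R.
Proof.
move=> cvlam cvlam_; rewrite leNgt; apply/negP => lamS.
set S := (\sum_l _)%R in lamS; pose c := ((lam + S) / 2)%R.
have lamc : (lam < c)%R by rewrite /c; lra.
have cS : (c < S)%R by rewrite /c; lra.
have lam0 : (0 <= lam)%R.
  apply: cvgr_to_ge cvlam _; apply: nearW => q.
  by rewrite /cond_prob divr_ge0// fine_ge0.
have c0 : (0 <= c)%R by exact: le_trans (ltW lamc).
have [e [e0 e1 he]] := near_tail_filter (cvgr_le _ cvlam _ lamc).
have hc x : 0 < nu (tail b x) < e%:E ->
    (cond_prob P [set t | tail b x (Z v t)] (nbs (tail b x)) <= c)%R.
  move=> /andP[x0 xe]; pose a := fine (nu (tail b x)).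
  have mt (y : R) : measurable (tail b y) by exact: measurable_tail.
  have aE : nu (tail b x) = a%:E by rewrite fineK//; apply: fin_num_measure;
    exact: mt.
  have a0e : (0 < a < e)%R by rewrite -!lte_fin -aE x0.
  have a01 : (0 < a < 1)%R by case/andP: a0e => -> ae; exact: lt_le_trans e1.
  apply: le_trans (he a a0e); set y := xq _.
  (* The limit only speaks of quantiles; an arbitrary [x] is replaced by the quantile [y] with the
     same tail mass. *)
  have yE : nu (tail b y) = nu (tail b x) by rewrite aE law_tail_quantile.
  have [mcy n1 n2] := closed_tail_congr b y.
  rewrite (cond_prob_congr mcy (mt y) n1 n2).
  by rewrite (cond_prob_congr (mt x) (mt y)) ?law_tailD_null.
have : (S <= c)%R.
  apply: (@cvgr_to_le _ (tail_filter R b) _ _ (fun q => \sum_(l < nb_size s L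
    v) w l *
    cond_prob (mu l) [set z | closed_tail b (xq q) z.1]
      [set z | forall _ : 'I_1, closed_tail b (xq q) z.2] / 2)%R).
    apply: cvg_sumr => l; apply: cvgMl; apply: cvgMr; exact: cvlam_.
  apply: filterS (tail_filter_near b e0) => q [a a0e ->].
  have /andP[a0 ae] := a0e.
  set x := xq _.
  have xE : nu (tail b x) = a%:E by rewrite law_tail_quantile// a0 (lt_le_trans
    ae).
  have := @sum_tail_square_le b x c e%:E c0 hc.
  rewrite xE lte_fin => /(_ ae) H.
  under eq_bigr do rewrite component_cond_probE xE/= mulrA.
  rewrite -!mulr_suml ler_pdivrMr// ler_pdivrMr//.
  rewrite -lee_fin -sumEFin.
  rewrite (_ : (c * 2 * a)%:E = 2%:E * (c%:E * a%:E)); last first.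
    by rewrite -!EFinM; congr EFin; ring.
  apply: le_trans H; apply: lee_sum => l _.
  rewrite EFinM fineK//; apply: fin_num_measure.
  by apply: measurableX; exact: measurable_tail.
by rewrite leNgt cS.
Qed.

End tail_of_location.

End stationary.

(** * The two coefficients as instances of the inequality for a general tail *)

Lemma quantile_eq_cdf d1 d2 (T1 : measurableType d1) (T2 : measurableType d2)
    (R : realType) (P : probability T1 R) (Q : probability T2 R)
    (X : {RV P >-> R}) (Y : {RV Q >-> R}) :
  (forall x, cdf X x = cdf Y x) -> quantile X = quantile Y.
Proof.
move=> XY; apply/funext => q; congr (inf _).
by apply/seteqP; split => x /=; rewrite XY.
Qed.

Theorem corollary1 (R : realType) (p n L : nat)
  (p_ge1 : (1 <= p)%N) (L_bounds : (0 < L < n)%N)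
  (* domain, reference set, neighbor sets *)
  (D : set 'rV[R]_p) (s : n.-tuple 'rV[R]_p)
  (s_uniq : uniq s) (s_D : forall j, D (tnth s j))
  (nb : forall v : 'rV[R]_p, 'I_(nb_size s L v) -> 'I_n)
  (nb_neighbors : forall v, D v -> is_neighbor_list s v (@nb v))
  (* base vectors and the spatially varying vectors built from them *)
  (Theta : 'I_L -> Type)
  (G : forall l : 'I_L, Theta l -> probability (R * R)%type R)
  (theta0 : forall l : 'I_L, Theta l)
  (theta : 'rV[R]_p -> forall l : 'I_L, Theta l)
  (base_ok : forall l : 'I_L, base_vector_properties (G l (theta0 l)))
  (law_ok : forall v, D v -> forall l : 'I_(nb_size s L v),
     base_vector_properties (spatial_law G theta l))
  (* the process *)
  (w : forall v : 'rV[R]_p, 'I_(nb_size s L v) -> R)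
  (f : forall v : 'rV[R]_p, 'I_(nb_size s L v) -> R -> R -> R)
  (f_cond : forall v, D v -> forall l : 'I_(nb_size s L v),
     is_cond_density (spatial_law G theta l) (f v l))
  (p1 : R -> R)
  (d : measure_display) (Omega : measurableType d) (P : probability Omega R)
  (Z : 'rV[R]_p -> {RV P >-> R})
  (Z_nnmp : is_nnmp D nb w f p1 Z)
  (* the conditioning variable V_{v,l} has the marginal law of Z(v_(l)) *)
  (V_marginal : forall v, D v -> forall (l : 'I_(nb_size s L v)) (x : R),
     cdf (Vcoord (spatial_law G theta l)) x = cdf (Z (tnth s (nb v l))) x)
  (* a location with a neighbor set, i.e., other than s_1 *)
  (v : 'rV[R]_p) (v_D : D v) (v_has_nb : (0 < index v s)%N) :
  (forall (lamH : R) (lamH_ : 'I_(nb_size s L v) -> R),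
     upper_tail_dependence (Z v) (fun l => Z (tnth s (nb v l))) lamH ->
     (forall l, upper_tail_dependence (Ucoord (spatial_law G theta l))
                  (fun _ : 'I_1 => Vcoord (spatial_law G theta l)) (lamH_ l)) ->
     \sum_(l < nb_size s L v) w v l * lamH_ l / 2 <= lamH) /\
  (forall (lamL : R) (lamL_ : 'I_(nb_size s L v) -> R),
     lower_tail_dependence (Z v) (fun l => Z (tnth s (nb v l))) lamL ->
     (forall l, lower_tail_dependence (Ucoord (spatial_law G theta l))
                  (fun _ : 'I_1 => Vcoord (spatial_law G theta l)) (lamL_ l)) ->
     \sum_(l < nb_size s L v) w v l * lamL_ l / 2 <= lamL).
Proof.
have n_gt0 : (0 < n)%N by case/andP: L_bounds => _; exact: leq_trans.
have cdf_stat u x : D u -> cdf (Z u) x = cdf (Z (s : seq _)`_0) x.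
  move=> uD; exact: (marginal_stationary s_uniq s_D nb_neighbors f_cond law_ok
    Z_nnmp V_marginal n_gt0 uD (measurable_itv _)).
(* Equality of all marginals reduces every quantile function in the coefficients to that of the
   first reference location. *)
have qZ u : D u -> quantile (Z u) = quantile (Z (s : seq _)`_0).
  by move=> uD; apply: quantile_eq_cdf => x; exact: cdf_stat.
have qV (l : 'I_(nb_size s L v)) :
    quantile (Vcoord (spatial_law G theta l)) = quantile (Z (s : seq _)`_0).
  rewrite -(qZ _ (s_D (nb v l))); apply: quantile_eq_cdf => x;
    exact: V_marginal.
have qU (l : 'I_(nb_size s L v)) :
    quantile (Ucoord (spatial_law G theta l)) = quantile (Z (s : seq _)`_0).
  rewrite -(qV l); apply: quantile_eq_cdf => x;
    exact: base_marginals (law_ok v v_D l) x.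
have nbE b q : [set t | forall l : 'I_(nb_size s L v),
      closed_tail b (quantile (Z (tnth s (nb v l))) q) (Z (tnth s (nb v l)) t)]
        =
    [set t | forall l : 'I_(nb_size s L v),
      closed_tail b (quantile (Z (s : seq _)`_0) q) (Z (tnth s (nb v l)) t)].
  by apply/seteqP; split => t h l; have := h l; rewrite (qZ _ (s_D _)).
have main b := tail_dependence_ge s_uniq s_D nb_neighbors f_cond law_ok
  Z_nnmp V_marginal n_gt0 v_D v_has_nb (b := b).
split=> lam lam_ cvlam cvlam_.
- apply: (main true) => [|l]; last first.
    by have := cvlam_ l; rewrite /upper_tail_dependence qU qV.
  under eq_fun do rewrite -nbE -(qZ v v_D).
  exact: cvlam.
- apply: (main false) => [|l]; last first.
    by have := cvlam_ l; rewrite /lower_tail_dependence qU qV.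
  under eq_fun do rewrite -nbE -(qZ v v_D).
  exact: cvlam.
Qed.
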